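(* Suppose the interface $\Gamma$ is $C^2$-smooth. Then there exist a constant $h_0>0$ and a constant $C>0$, independent of $h$ and of how $\Gamma$ cuts the mesh, such that for every mesh $\mathcal T_h$ as in the context with $h<h_0$, $$\|w\|_{L^\infty(\Gamma_K)}\le C\,h_K^{(1-d)/2}\Big(\|w\|_{L^2(\Gamma_{B_{\tau(K)}})}+h_K^{1/2}\|\nabla w\|_{L^2(K)}\Big),\qquad\forall w\in\mathbb P_m(B_{\tau(K)}),\ \forall K\in\mathcal T_h^\Gamma.$$
   Context: $\Omega\subset\mathbb R^d$ ($d=2,3$) is an open polygonal (polyhedral) domain, and $\Gamma\Subset\Omega$ is an interface separating $\Omega$ into two disjoint subdomains $\Omega_0,\Omega_1$ with $\overline\Omega_0\cup\overline\Omega_1=\overline\Omega$. $\mathcal T_h$ is a partition of $\Omega$ into triangles (tetrahedra), not required to be aligned with $\Gamma$; $h_K$ is the diameter of $K$, $\rho_K$ the radius of its largest inscribed ball, $h=\max_Kh_K$, $\rho=\min_K\rho_K$, and $h\le C_\nu\rho$ with $C_\nu$ independent of $h$ (quasi-uniformity). $\mathcal T_h^\Gamma=\{K\in\mathcal T_h:K\cap\Gamma\ne\varnothing\}$ is the set of cut elements. Standing assumptions: no closed cut element meets $\partial\Omega$, and for every $K\in\mathcal T_h^\Gamma$ and $i=0,1$ there is an element $K'\in\mathcal T_h$ with $K'\subset\Omega_i$ and $\overline{K'}\cap\overline K\neq\varnothing$. For $K\in\mathcal T_h^\Gamma$: $\Gamma_K=K\cap\Gamma$, $\mathbf x_K$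 is the barycenter of $K$, $B_{\tau(K)}=B(\mathbf x_K,h_K)$ is the ball of radius $h_K$ centered at $\mathbf x_K$, and $\Gamma_{B_{\tau(K)}}=\Gamma\cap B_{\tau(K)}$. $m\ge1$ is a fixed integer and $\mathbb P_m(D)$ is the space of polynomials of degree at most $m$ on $D$. *)

(* Defs.v *)
From HB Require Import structures.
From mathcomp Require Import all_boot all_order all_algebra.
From mathcomp Require Import all_classical all_reals all_analysis.
From mathcomp Require mpoly.
(* its notations clash with those of the analysis library *)
Import -(notations) mpoly.

Set Implicit Arguments.
Unset Strict Implicit.
Unset Printing Implicit Defensive.

Import Order.TTheory GRing.Theory Num.Theory.
Import numFieldNormedType.Exports.

Local Open Scope classical_set_scope.
Local Open Scope ring_scope.

(* The norm and the balls that the library puts on 'rV[R]_n are those of the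
   sup norm. It induces the same topology, so the library's open, closure,
   compact, continuous, ... are used as they are; lengths, balls and diameters
   have to be redefined. *)
Section euclidean.
Context {R : realType} {n : nat}.
Implicit Types (x c : 'rV[R]_n) (A : set 'rV[R]_n).

Definition enorm x : R := Num.sqrt (\sum_i x 0 i ^+ 2).

Definition eball c (r : R) : set 'rV[R]_n := [set x | enorm (x - c) < r].

(* [ediam set0] is -oo *)
Definition ediam A : \bar R :=
  ereal_sup [set (enorm (p.1 - p.2))%:E | p in A `*` A].

Definition frontier A : set 'rV[R]_n := closure A `\` interior A.

Definition grad (w : 'rV[R]_n -> R) x : 'rV[R]_n :=
  \row_i 'D_(delta_mx 0 i) w x.

Fixpoint Ck (k : nat) (f : 'rV[R]_n -> R) : Prop :=
  continuous f /\
  if k is j.+1 then forall i : 'I_n,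
    (forall x, derivable f x (delta_mx 0 i)) /\
    Ck j (fun x => 'D_(delta_mx 0 i) f x)
  else True.

End euclidean.

(* All sets are measurable: with this structure the library's [mu_ext] ranges
   over arbitrary countable covers; used only to derive the outer measure
   properties of [cover_outer] below. *)
Definition discrete_sets (T : Type) : Type := T.

Section discrete_sets.
Variable T : pointedType.
Let m0 : [set: set T] set0. Proof. by []. Qed.
Let mC (A : set T) : [set: set T] A -> [set: set T] (~` A). Proof. by []. Qed.
Let mU (F : (set T)^nat) :
  (forall i, [set: set T] (F i)) -> [set: set T] (\bigcup_i F i).
Proof. by []. Qed.
HB.instance Definition _ := Pointed.on (discrete_sets T).
HB.instance Definition _ := @isMeasurable.Build default_measure_display
  (discrete_sets T) [set: set T] m0 mC mU.
End discrete_sets.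

Section cover_outer.
Context {R : realType} {T : pointedType} (zeta : set T -> \bar R).
Local Open Scope ereal_scope.

Definition cover_outer (A : set T) : \bar R :=
  ereal_inf [set \sum_(k <oo) zeta (F k) |
             F in [set F : (set T)^nat | A `<=` \bigcup_k F k]].

Lemma cover_outerE (A : set T) :
  cover_outer A = @mu_ext _ (discrete_sets T : measurableType _) R zeta A.
Proof.
rewrite /cover_outer /mu_ext; congr (ereal_inf (_ @` _)).
by apply/seteqP; split => F /=; [move=> AF; split | case].
Qed.

Hypotheses (zeta0 : zeta set0 = 0) (zeta_ge0 : forall A, 0 <= zeta A).

Lemma cover_outer0 : cover_outer set0 = 0.
Proof. by rewrite cover_outerE; exact: mu_ext0. Qed.

Lemma cover_outer_ge0 A : 0 <= cover_outer A.
Proof. by rewrite cover_outerE; exact: mu_ext_ge0. Qed.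

Lemma le_cover_outer : {homo cover_outer : A B / A `<=` B >-> A <= B}.
Proof. by move=> A B AB; rewrite !cover_outerE; exact: le_mu_ext. Qed.

Lemma cover_outer_sigma_subadditive : sigma_subadditive cover_outer.
Proof.
move=> F; rewrite cover_outerE; under eq_eseriesr do rewrite cover_outerE.
exact: (@mu_ext_sigma_subadditive _ (discrete_sets T : measurableType _)).
Qed.

End cover_outer.

Section lebesgue_rV.
Context {R : realType} {n : nat}.
Local Open Scope ereal_scope.

Definition box (a b : 'rV[R]_n) : set 'rV[R]_n :=
  [set x | forall i, (a 0 i <= x 0 i <= b 0 i)%R].

(* The volume of [A] if [A] is a nonempty box, +oo if it is not a box: only
   boxes count in a cover. *)
Definition box_volume (A : set 'rV[R]_n) : \bar R :=
  if A == set0 then 0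
  else ereal_inf [set (\prod_i (p.2 0 i - p.1 0 i))%:E |
                  p in [set p | A = box p.1 p.2]].

(* n-dimensional Lebesgue outer measure *)
Definition lebesgue_rV : set 'rV[R]_n -> \bar R := cover_outer box_volume.

Let box_volume0 : box_volume set0 = 0. Proof. by rewrite /box_volume eqxx. Qed.

Let box_volume_ge0 A : 0 <= box_volume A.
Proof.
rewrite /box_volume; case: eqVneq => // /eqP/eqP/set0P[x Ax].
apply: le_ereal_inf_tmp => _ [[a b] /= AE <-]; rewrite lee_fin.
apply: prodr_ge0 => i _; rewrite subr_ge0.
by move: Ax; rewrite AE => /(_ i)/andP[]; exact: le_trans.
Qed.

HB.instance Definition _ := isOuterMeasure.Build R 'rV[R]_n lebesgue_rV
  (cover_outer0 box_volume0 box_volume_ge0) (cover_outer_ge0 box_volume_ge0)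
  (@le_cover_outer _ _ box_volume)
  (cover_outer_sigma_subadditive box_volume_ge0).

End lebesgue_rV.

Section hausdorff.
Context {R : realType} {n : nat} (s : nat).
Local Open Scope ereal_scope.

(* volume of the Euclidean unit ball of R^k *)
Fixpoint unit_ball_volume (k : nat) : R :=
  match k with
  | 0 => 1
  | 1 => 2
  | j.+2 => 2 * pi / j.+2%:R * unit_ball_volume j
  end%R.

Definition hausdorff_weight (delta : R) (A : set 'rV[R]_n) : \bar R :=
  if A == set0 then 0
  else if ediam A <= delta%:E
  then (unit_ball_volume s * (fine (ediam A) / 2) ^+ s)%:E
  else +oo.

(* s-dimensional Hausdorff outer measure, normalized so as to be the surface
   measure on s-dimensional surfaces *)
Definition hausdorff (A : set 'rV[R]_n) : \bar R :=
  ereal_sup [set cover_outer (hausdorff_weight delta) A |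
             delta in [set delta : R | (0 < delta)%R]].

Let ubv_ge0 k : (0 <= unit_ball_volume k)%R.
Proof.
suff: (0 <= unit_ball_volume k /\ 0 <= unit_ball_volume k.+1)%R by case.
elim: k => [|k [h0 h1]]; first by split=> /=.
split=> //; rewrite /= -/(unit_ball_volume _).
by rewrite mulr_ge0// divr_ge0// mulr_ge0// pi_ge0.
Qed.

Let weight0 delta : hausdorff_weight delta set0 = 0.
Proof. by rewrite /hausdorff_weight eqxx. Qed.

Let weight_ge0 delta A : 0 <= hausdorff_weight delta A.
Proof.
rewrite /hausdorff_weight; case: eqVneq => // /eqP/eqP/set0P[x Ax].
case: ifP => // _; rewrite lee_fin mulr_ge0// exprn_ge0// divr_ge0//.
apply: fine_ge0; apply: ereal_sup_ubound; exists (x, x) => //=.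
rewrite /enorm big1 ?sqrtr0// => i _.
by rewrite !mxE subrr expr0n.
Qed.

Let hausdorff0 : hausdorff set0 = 0.
Proof.
apply/eqP; rewrite eq_le; apply/andP; split.
  by apply: ge_ereal_sup => _ [e /= _ <-]; rewrite cover_outer0.
by apply: ereal_sup_ubound; exists 1%R => /=; rewrite ?ltr01 ?cover_outer0.
Qed.

Let hausdorff_ge0 A : 0 <= hausdorff A.
Proof.
apply: (@le_trans _ _ (cover_outer (hausdorff_weight 1) A)).
  exact: cover_outer_ge0.
by apply: ereal_sup_ubound; exists 1%R => /=; rewrite ?ltr01.
Qed.

Let le_hausdorff : {homo hausdorff : A B / A `<=` B >-> A <= B}.
Proof.
move=> A B AB; apply: ge_ereal_sup => _ [e /= e0 <-].
apply: (le_trans (@le_cover_outer _ _ (hausdorff_weight e) _ _ AB)).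
by apply: ereal_sup_ubound; exists e.
Qed.

Let hausdorff_sigma_subadditive : sigma_subadditive hausdorff.
Proof.
move=> F; apply: ge_ereal_sup => _ [e /= e0 <-].
apply: (le_trans (cover_outer_sigma_subadditive (weight_ge0 e) F)).
apply: lee_nneseries => [i _ _|i _]; first exact: cover_outer_ge0.
by apply: ereal_sup_ubound; exists e.
Qed.

HB.instance Definition _ := isOuterMeasure.Build R 'rV[R]_n hausdorff
  hausdorff0 hausdorff_ge0 le_hausdorff hausdorff_sigma_subadditive.

End hausdorff.

(* L^p norm over [A], w.r.t. the measure that [mu] induces on its Caratheodory
   sigma-algebra: the norm of the extension of [f] by 0 outside of [A]. *)
Definition Lnorm_on {R : realType} {T : pointedType}
    (mu : {outer_measure set T -> \bar R}) (p : \bar R)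
    (A : set T) (f : T -> R) : \bar R :=
  @Lnorm _ (caratheodory_type mu) R mu p ((EFin \o f) \_ A).

(* Simplices are given by the matrix of their vertices, one per row. *)
Section simplices.
Context {R : realType} {k d : nat}.
Implicit Type V : 'M[R]_(k, d).

Definition affinely_independent V : bool :=
  row_free (row_mx V (const_mx 1 : 'cV[R]_k)).

Definition closed_simplex V : set 'rV[R]_d :=
  [set l *m V | l in
    [set l : 'rV[R]_k | (forall i, 0 <= l 0 i) /\ \sum_i l 0 i = 1]].

Definition open_simplex V : set 'rV[R]_d :=
  [set l *m V | l in
    [set l : 'rV[R]_k | (forall i, 0 < l 0 i) /\ \sum_i l 0 i = 1]].

Definition barycenter V : 'rV[R]_d := k%:R^-1 *: \sum_i row i V.

Definition diameter V : R := fine (ediam (open_simplex V)).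

Definition inradius V : R :=
  sup [set r | 0 < r /\ exists c, eball c r `<=` open_simplex V].

End simplices.

Section geometry.
Context {R : realType} {d : nat}.
Implicit Types Omega Gamma : set 'rV[R]_d.

Record polyhedral_domain Omega : Prop := {
  domain_open : open Omega ;
  domain_nonempty : Omega !=set0 ;
  domain_connected : connected Omega ;
  domain_bounded : bounded_set Omega ;
  domain_frontier : exists (N : nat) (F : 'I_N -> 'M[R]_(d, d)),
    (forall i, affinely_independent (F i)) /\
    frontier Omega = \bigcup_(i in [set: 'I_N]) closed_simplex (F i)
}.

Record interface Omega Gamma (Omega_ : 'I_2 -> set 'rV[R]_d) : Prop := {
  interface_compact : compact (closure Gamma) ;
  interface_inside : closure Gamma `<=` Omega ;
  subdomain_open : forall i, open (Omega_ i) ;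
  subdomain_nonempty : forall i, Omega_ i !=set0 ;
  subdomain_disjoint : Omega_ 0 `&` Omega_ 1 = set0 ;
  subdomain_cover : Omega_ 0 `|` Omega_ 1 = Omega `\` Gamma ;
  subdomain_closure : closure (Omega_ 0) `|` closure (Omega_ 1) = closure Omega ;
  interface_frontier : Gamma = frontier (Omega_ 0) `&` frontier (Omega_ 1)
}.

(* Locally, one coordinate is a C^2 function of the other ones. *)
Definition C2_smooth Gamma : Prop :=
  forall x, Gamma x -> exists (j : 'I_d) (g : 'rV[R]_d.-1 -> R),
    Ck 2 g /\ \forall y \near x, Gamma y <-> y 0 j = g (col' j y).

(* The elements are open simplices. *)
Record mesh Omega (N : nat) (K : 'I_N -> 'M[R]_(d.+1, d)) : Prop := {
  mesh_simplex : forall i, affinely_independent (K i) ;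
  mesh_disjoint : forall i j, i != j ->
    open_simplex (K i) `&` open_simplex (K j) = set0 ;
  mesh_inside : forall i, open_simplex (K i) `<=` Omega ;
  mesh_cover : \bigcup_(i in [set: 'I_N]) closure (open_simplex (K i)) =
    closure Omega
}.

Definition mesh_size (N : nat) (K : 'I_N -> 'M[R]_(d.+1, d)) : R :=
  sup (range (fun i => diameter (K i))).

Definition mesh_inradius (N : nat) (K : 'I_N -> 'M[R]_(d.+1, d)) : R :=
  inf (range (fun i => inradius (K i))).

Definition cuts Gamma (V : 'M[R]_(d.+1, d)) : Prop :=
  open_simplex V `&` Gamma !=set0.

Record admissible_cuts Omega Gamma (Omega_ : 'I_2 -> set 'rV[R]_d)
    (N : nat) (K : 'I_N -> 'M[R]_(d.+1, d)) : Prop := {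
  cut_inside : forall i, cuts Gamma (K i) ->
    closure (open_simplex (K i)) `&` frontier Omega = set0 ;
  cut_neighbor : forall i, cuts Gamma (K i) -> forall j : 'I_2, exists i',
    open_simplex (K i') `<=` Omega_ j /\
    closure (open_simplex (K i')) `&` closure (open_simplex (K i)) !=set0
}.

Definition poly_on (m : nat) (D : set 'rV[R]_d) : set ('rV[R]_d -> R) :=
  [set w | exists2 p : mpoly d R, (mpoly.msize p <= m.+1)%N &
    forall x, D x -> w x = meval (fun i => x 0 i) p].

End geometry.

(* Main.v *)
Require Import Defs.
From mathcomp Require Import all_boot all_order all_algebra.
From mathcomp Require Import all_classical all_reals all_analysis.
From mathcomp Require Import measurable_realfun ess_sup_inf qpoly.
From mathcomp Require mpoly.
Import -(notations) mpoly.
From mathcomp Require Import ring lra.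

Set Implicit Arguments.
Unset Strict Implicit.
Unset Printing Implicit Defensive.

Import Order.TTheory GRing.Theory Num.Theory.
Import numFieldNormedType.Exports.

Local Open Scope classical_set_scope.
Local Open Scope ring_scope.

(** On a cut element [K] of diameter [h], fix [x] on [Gamma] inside [K]. Two facts
    give the estimate; the way in which [Gamma] cuts [K] enters neither of them.

    The oscillation of [w] is controlled by its gradient on [K]. Each partial
    derivative of the polynomial is a polynomial of bounded degree, so its maximum
    over the ball [B] is at most a constant times its value at one node of a
    Lagrange grid inside a cube inscribed in [K], and near that node it stays above
    half of that value, on a cube of side comparable to [h]
    ([polynomial_norm_equivalence]). The volume of the small cube turns this into a
    bound of the gradient on [B] by [h ^ (- d / 2)] times its L^2 norm on [K], and
    the mean value theorem gives
    [|w x - w y| <= C * h ^ (1 - d / 2) * ||grad w||] for [y] within distance [h]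
    of [x] ([polynomial_oscillation]).

    The surface [Gamma] has area at least [c * h ^ (d - 1)] near [x]: locally it is
    the graph of a Lipschitz function, hence it projects onto a cube of side
    comparable to [h] in a coordinate hyperplane, and projections do not increase
    the Hausdorff measure; compactness of [Gamma] makes the constants uniform
    ([C2_compact_measure_ge]). So [|w|] is at most
    [C * h ^ ((1 - d) / 2) * ||w||] somewhere on the part of [Gamma] near [x], up
    to an arbitrarily small error, and adding the oscillation bounds [w x].

    All the measures involved are outer measures defined by covers. A lower bound
    for the measure of a set says that every cover of a cube by boxes has at least
    the volume of the cube, which is Fubini for weighted indicator functions
    ([weighted_box_cover]). A lower bound for an L^2 norm, whose integrand need not
    be measurable, also needs the set to be Caratheodory measurable: for the
    Lebesgue measure boxes suffice, for the Hausdorff measure closed sets are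
    measurable because it is additive on sets at positive distance
    ([separated_caratheodory]). *)

(** * Covers of a cube by boxes *)

Lemma lebesgue_measure_segment (R : realType) (a b : R) : a <= b ->
  lebesgue_measure (`[a, b]%classic : set R) = (b - a)%:E.
Proof.
move=> ab; rewrite lebesgue_measure_itv /= lte_fin; case: ltP => // ba.
have -> : a = b by apply/eqP; rewrite eq_le ab ba.
by rewrite subrr.
Qed.

(** Fubini's theorem for the simple function with weights [c k] on the boxes: by
    induction on the dimension, each slice of the cube orthogonal to the last axis
    is covered by the slices of the boxes that meet it. The weights are what makes
    the induction go through, since the boxes that miss the slice get weight 0. *)
Lemma weighted_box_cover (R : realType) (n : nat) (u l : nat -> R)
    (a b : nat -> nat -> R) (c : nat -> R) (gamma : R) :
  0 <= gamma -> (forall i, 0 <= l i) -> (forall k, 0 <= c k) ->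
  (forall k i, a k i <= b k i) ->
  (forall x : nat -> R,
    (forall i, (i < n)%N -> u i <= x i <= u i + l i) ->
    (gamma%:E <=
     \sum_(k <oo) (c k * \prod_(i < n) (a k i <= x i <= b k i)%R%:R)%:E)%E) ->
  ((gamma * \prod_(i < n) l i)%:E <=
   \sum_(k <oo) (c k * \prod_(i < n) (b k i - a k i))%:E)%E.
Proof.
move=> g0 l0 + ab; elim: n c => [|n IH] c c0 H.
  rewrite big_ord0 mulr1; apply: le_trans (H u _) _ => //.
  by apply: lee_nneseries => k *; rewrite ?big_ord0 ?mulr1 ?lee_fin.
pose D := `[u n, u n + l n]%classic.
pose f k (t : R) : \bar R := ((c k * \prod_(i < n) (b k i - a k i))%:E *
   (\1_(`[a k n, b k n]%classic) t)%:E)%E.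
have v0 k : 0 <= c k * \prod_(i < n) (b k i - a k i).
  by rewrite mulr_ge0// prodr_ge0// => i _; rewrite subr_ge0.
have f0 k t : (0 <= f k t)%E by rewrite mule_ge0// lee_fin.
have mf k : measurable_fun D (f k).
  apply: measurable_funeM; apply/measurable_EFinP.
  exact: measurable_indic.
have mD : measurable D by exact: measurable_itv.
have slice t : D t -> ((gamma * \prod_(i < n) l i)%:E <= \sum_(k <oo) f k t)%E.
  rewrite /D /= in_itv /= => tD.
  have -> : (\sum_(k <oo) f k t)%E = (\sum_(k <oo)
     ((c k * (a k n <= t <= b k n)%R%:R) * \prod_(i < n) (b k i - a k i))%:E)%E.
    apply: eq_eseriesr => k _; rewrite /f -EFinM indicE mem_setE in_itv /=.
    by congr _%:E; ring.
  apply: IH => [k|x xD]; first by rewrite mulr_ge0.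
  pose y i := if (i < n)%N then x i else t.
  have yD i : (i < n.+1)%N -> u i <= y i <= u i + l i.
    rewrite ltnS leq_eqVlt /y; case: ifP => [/xD//|_] /orP[/eqP->//|//].
  apply: le_trans (H y yD) _; apply: lee_nneseries => k *.
    by rewrite lee_fin mulr_ge0// prodr_ge0.
  have -> : \prod_(i < n.+1) (a k i <= y i <= b k i)%R%:R =
      \prod_(i < n) (a k i <= x i <= b k i)%R%:R * (a k n <= t <= b k n)%R%:R :> R.
    have yn : y n = t by rewrite /y ltnn.
    rewrite big_ord_recr /= yn; congr (_ * _).
    by apply: eq_bigr => i _; rewrite /y ltn_ord.
  by rewrite lee_fin mulrA mulrAC.
have LD : lebesgue_measure D = (l n)%:E.
  by rewrite lebesgue_measure_segment ?lerDl// addrAC subrr add0r.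
have : (\int[lebesgue_measure]_(x in D) cst (gamma * \prod_(i < n) l i)%:E x <=
        \int[lebesgue_measure]_(x in D) \sum_(k <oo) f k x)%E.
  apply: ge0_le_integral => //.
  - by move=> t _; rewrite lee_fin mulr_ge0// prodr_ge0.
  - by have := @ge0_emeasurable_sum _ _ _ D f predT; apply.
have -> : (\int[lebesgue_measure]_(x in D) cst (gamma * \prod_(i < n) l i)%:E x
    = (gamma * \prod_(i < n.+1) l i)%:E)%E.
  rewrite integral_cst// big_ord_recr /= mulrA [RHS]EFinM.
  by congr (_ * _)%E; exact: LD.
rewrite integral_nneseries//.
move/le_trans; apply.
apply: lee_nneseries => k *; first by apply: integral_ge0 => *; exact: f0.
rewrite /f ge0_integralZl//; last 2 first.
  by apply/measurable_EFinP; exact: measurable_indic.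
  by rewrite lee_fin.
rewrite big_ord_recr /= mulrA [leRHS]EFinM; apply: lee_wpmul2l; first by rewrite lee_fin.
rewrite integral_indic; [|exact: mD|exact: measurable_itv].
rewrite -lebesgue_measure_segment//.
by apply: le_measure; rewrite ?inE//; apply: measurableI; exact: measurable_itv.
Qed.

(** Coordinates indexed by [nat] free the induction on the dimension from casts
    between row vectors of different lengths. *)
Definition natcoord (R : realType) (n : nat) (x : 'rV[R]_n) (i : nat) : R :=
  oapp (fun j => x 0 j) 0 (insub i).

Lemma natcoordE (R : realType) (n : nat) (x : 'rV[R]_n) (i : 'I_n) :
  natcoord x i = x 0 i.
Proof. by rewrite /natcoord valK. Qed.

Lemma box_cover_volume (R : realType) (n : nat) (u v : 'rV[R]_n) (P : pred nat)
    (a b : nat -> 'rV[R]_n) :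
  (forall i, u 0 i <= v 0 i) ->
  (forall k, P k -> forall i, a k 0 i <= b k 0 i) ->
  box u v `<=` \bigcup_(k in [set k | P k]) box (a k) (b k) ->
  ((\prod_i (v 0 i - u 0 i))%:E <=
   \sum_(k <oo | P k) (\prod_i (b k 0 i - a k 0 i))%:E)%E.
Proof.
move=> uv ab cover.
pose b' k i := Num.max (natcoord (a k) i) (natcoord (b k) i).
pose l i := Num.max 0 (natcoord v i - natcoord u i).
have b'E k (i : 'I_n) : P k -> b' k i = b k 0 i.
  by move=> Pk; rewrite /b' !natcoordE; apply/max_idPr/ab.
have lE (i : 'I_n) : l i = v 0 i - u 0 i.
  by rewrite /l !natcoordE; apply/max_idPr; rewrite subr_ge0.
have := @weighted_box_cover R n (natcoord u) l (fun k => natcoord (a k)) b'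
  (fun k => (P k)%:R) 1 ler01.
have -> : 1 * \prod_(i < n) l i = \prod_i (v 0 i - u 0 i).
  by rewrite mul1r; apply: eq_bigr => i _; exact: lE.
rewrite [X in _ -> (_ <= X)%E]eseries_mkcond.
have -> : (\sum_(k <oo) ((P k)%:R * \prod_(i < n) (b' k i - natcoord (a k) i))%:E
  = \sum_(k <oo) if P k then (\prod_i (b k 0 i - a k 0 i))%:E else 0)%E.
  apply: eq_eseriesr => k _; case: ifPn => Pk; rewrite ?mul0r// mul1r.
  by congr _%:E; apply: eq_bigr => i _; rewrite b'E ?natcoordE.
apply => [i|k|k i|x xuv]; rewrite ?ler0n /l ?le_max ?lexx //.
have [|k /= Pk kx] := cover (\row_i x i).
  move=> i; rewrite mxE; have := xuv i (ltn_ord i).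
  by rewrite lE natcoordE addrC subrK.
have kx1 : \prod_(i < n) (natcoord (a k) i <= x i <= b' k i)%R%:R = 1 :> R.
  apply: big1 => i _; rewrite b'E// natcoordE.
  by move: (kx i); rewrite mxE => ->.
apply: le_trans (nneseries_lim_ge k.+1 _); last first.
  by move=> j _ _; rewrite lee_fin mulr_ge0// prodr_ge0.
rewrite big_mkord big_ord_recr /= Pk mul1r kx1 leeDr//.
by apply: sume_ge0 => j _; rewrite lee_fin mulr_ge0// prodr_ge0.
Qed.

(** * Outer measures defined by covers, and the Lebesgue measure of boxes *)

Lemma cover_outer_le (R : realType) (T : pointedType) (zeta : set T -> \bar R)
    (A : set T) (F : (set T)^nat) :
  A `<=` \bigcup_k F k -> (cover_outer zeta A <= \sum_(k <oo) zeta (F k))%E.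
Proof. by move=> AF; apply: ereal_inf_lbound; exists F. Qed.

(** Splitting each member of a cover of [X] yields covers of the two parts of [X].
    It serves twice: with the members cut along a hyperplane when they are boxes,
    and with each member kept whole when [A] and [B] are separated. *)
Lemma cover_outer_split (R : realType) (T : pointedType)
    (zeta : set T -> \bar R) (A B X : set T) :
  (forall S, (0 <= zeta S)%E) ->
  (forall S, exists S1 S2, [/\ S `&` A `<=` S1, S `&` B `<=` S2 &
     (zeta S1 + zeta S2 <= zeta S)%E]) ->
  (cover_outer zeta (X `&` A) + cover_outer zeta (X `&` B)
   <= cover_outer zeta X)%E.
Proof.
move=> z0 split; apply: le_ereal_inf_tmp => _ [F /= XF <-].
have /choice[S1 /choice[S2 HS]] := fun k => split (F k).
apply: (@le_trans _ _ (\sum_(k <oo) (zeta (S1 k) + zeta (S2 k)))%E); last first.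
  by apply: lee_nneseries => [k _ _|k _]; [rewrite adde_ge0|case: (HS k)].
rewrite nneseriesD//; apply: leeD; apply: cover_outer_le.
  by move=> x [/XF[k _ Fx] Ax]; exists k => //; have [+ _ _] := HS k; exact.
by move=> x [/XF[k _ Fx] Bx]; exists k => //; have [_ + _] := HS k; exact.
Qed.

Lemma box_volume_ge0 (R : realType) (n : nat) (A : set 'rV[R]_n) :
  (0 <= box_volume A)%E.
Proof.
rewrite /box_volume; case: eqVneq => // /eqP/eqP/set0P[x Ax].
apply: le_ereal_inf_tmp => _ [[a b] /= AE <-]; rewrite lee_fin.
apply: prodr_ge0 => i _; rewrite subr_ge0.
by move: Ax; rewrite AE => /(_ i)/andP[]; exact: le_trans.
Qed.

(** The endpoints of a nonempty box are determined by the box, so the infimum that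
    defines its volume is over a single representation. *)
Lemma box_volume_box (R : realType) (n : nat) (a b : 'rV[R]_n) :
  (forall i, a 0 i <= b 0 i) ->
  box_volume (box a b) = (\prod_i (b 0 i - a 0 i))%:E.
Proof.
move=> ab; have aB : box a b a by move=> i; rewrite lexx ab.
have bB : box a b b by move=> i; rewrite lexx ab.
rewrite /box_volume ifF; last by apply/negP => /eqP E; rewrite E in aB.
apply/eqP; rewrite eq_le; apply/andP; split.
  by apply: ereal_inf_lbound; exists (a, b).
apply: le_ereal_inf_tmp => _ [[a' b'] /= E <-]; rewrite lee_fin.
rewrite E in aB bB; apply: ler_prod => i _; rewrite subr_ge0 ab /=.
by apply: lerB; [have /andP[] := bB i|have /andP[] := aB i].
Qed.

Lemma box_volumeP (R : realType) (n : nat) (A : set 'rV[R]_n) :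
  [\/ A = set0, box_volume A = +oo%E |
    exists a b, A = box a b /\ forall i, a 0 i <= b 0 i].
Proof.
have [->|A0] := eqVneq A set0; first by constructor 1.
have [[a [b E]]|nbox] := pselect (exists a b, A = box a b).
  constructor 3; exists a, b; split=> // i.
  have /set0P[x] := A0; rewrite E => /(_ i)/andP[]; exact: le_trans.
constructor 2; rewrite /box_volume (negPf A0).
apply/eqP; rewrite -leye_eq; apply: le_ereal_inf_tmp => y [[a b] /= E _].
by case: nbox; exists a, b.
Qed.

Lemma lebesgue_rV_box_ge (R : realType) (n : nat) (a b : 'rV[R]_n) :
  (forall i, a 0 i <= b 0 i) ->
  ((\prod_i (b 0 i - a 0 i))%:E <= lebesgue_rV (box a b))%E.
Proof.
move=> ab; apply: le_ereal_inf_tmp => _ [F /= cover <-].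
(* a cover with a member that is not a box has infinite total volume *)
have [[k Fk]|finF] := pselect (exists k, box_volume (F k) = +oo%E).
  rewrite (@nneseries_pinfty _ _ _ k) ?leey// => j _; exact: box_volume_ge0.
have /choice[A /choice[B FE]] : forall k, exists a b,
    F k !=set0 -> F k = box a b /\ forall i, a 0 i <= b 0 i.
  move=> k; case: (box_volumeP (F k)) => [->|Fk|[a' [b' ?]]].
  - by exists 0, 0 => -[].
  - by case: finF; exists k.
  - by exists a', b'.
pose P k := `[< F k !=set0 >].
apply: le_trans (box_cover_volume (P := P) (a := A) (b := B) ab _ _) _.
- by move=> k /asboolP/FE[].
- move=> x /cover[k _ Fx]; have Fk : F k !=set0 by exists x.
  by exists k; [exact/asboolP|have [<-] := FE k Fk].
rewrite eseries_mkcond; apply: lee_nneseries => [k _ _|k _]; case: ifPn => //.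
- move=> /asboolP/FE[_ AB]; rewrite lee_fin prodr_ge0// => i _.
  by rewrite subr_ge0.
- by move=> /asboolP/FE[-> AB]; rewrite box_volume_box.
- by move=> _; exact: box_volume_ge0.
Qed.

(** A coordinate hyperplane cuts a box into two boxes whose volumes add up. [A]
    stands for the open or for the closed half-space. *)
Lemma box_volume_split (R : realType) (n : nat) (i : 'I_n) (t : R)
    (A : set 'rV[R]_n) :
  A `<=` [set x | x 0 i <= t] -> ~` A `<=` [set x | t <= x 0 i] ->
  forall S, exists S1 S2, [/\ S `&` A `<=` S1, S `&` ~` A `<=` S2 &
     (box_volume S1 + box_volume S2 <= box_volume S)%E].
Proof.
move=> At nAt S; case: (box_volumeP S) => [->|Soo|[a [b [-> ab]]]].
- exists set0, set0; split; rewrite ?set0I// /box_volume eqxx adde0//.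
- exists S, S; split; rewrite ?Soo ?leey//; exact: subIsetl.
have v0 : box_volume (@set0 'rV[R]_n) = 0%E by rewrite /box_volume eqxx.
have [ta|at_] := ltP t (a 0 i).
  exists set0, (box a b); split; [|exact: subIsetl|by rewrite v0 add0e].
  move=> x [xB /At /= xt]; have /andP[ax _] := xB i.
  by have := lt_le_trans ta (le_trans ax xt); rewrite ltxx.
have [bt|tb] := ltP (b 0 i) t.
  exists (box a b), set0; split; [exact: subIsetl| |by rewrite v0 adde0].
  move=> x [xB /nAt /= xt]; have /andP[_ xb] := xB i.
  by have := lt_le_trans bt (le_trans xt xb); rewrite ltxx.
pose up (c : 'rV[R]_n) : 'rV[R]_n := \row_j if j == i then t else c 0 j.
exists (box a (up b)), (box (up a) b); split.
- move=> x [xB /At /= xt] j; rewrite mxE; have := xB j.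
  by case: eqP => [->|//] /andP[->].
- move=> x [xB /nAt /= xt] j; rewrite mxE; have := xB j.
  by case: eqP => [->|//] /andP[_ ->]; rewrite andbT.
have E (c : 'rV[R]_n) j : j != i -> up c 0 j = c 0 j.
  by rewrite mxE => /negPf ->.
have Ei c : up c 0 i = t by rewrite mxE eqxx.
rewrite !box_volume_box//; last 2 first.
- by move=> j; rewrite mxE; case: eqP => [->|].
- by move=> j; rewrite mxE; case: eqP => [->|].
rewrite -EFinD lee_fin (bigD1 i)//= (bigD1 i (F := fun j => b 0 j - up a 0 j))//=.
rewrite (bigD1 i (F := fun j => b 0 j - a 0 j))//= !Ei.
rewrite (eq_bigr (fun j => b 0 j - a 0 j)); last by move=> j ?; rewrite E.
rewrite [X in _ + _ * X](eq_bigr (fun j => b 0 j - a 0 j)); last first.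
  by move=> j ?; rewrite E.
by rewrite -mulrDl; rewrite [t - _ + _]addrC addrA subrK.
Qed.

Lemma caratheodory_box (R : realType) (n : nat) (a b : 'rV[R]_n) :
  (lebesgue_rV.-caratheodory) (box a b).
Proof.
have half (i : 'I_n) t (A : set 'rV[R]_n) : A `<=` [set x | x 0 i <= t] ->
    ~` A `<=` [set x | t <= x 0 i] -> lebesgue_rV.-caratheodory A.
  move=> At nAt; apply: le_caratheodory_measurable => X.
  apply: cover_outer_split; first exact: box_volume_ge0.
  exact: (box_volume_split At nAt).
have -> : box a b = \bigcap_(i in [set: 'I_n])
    (~` [set x : 'rV[R]_n | x 0 i < a 0 i] `&` [set x | x 0 i <= b 0 i]).
  apply/seteqP; split=> x xB i => [_|]; have := xB i.
    by move=> /andP[ax xb]; split=> //=; apply/negP; rewrite -leNgt.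
  by move=> /(_ I)[/= /negP]; rewrite -leNgt => -> ->.
apply: (@fin_bigcap_measurable _ (caratheodory_type lebesgue_rV)) => //.
move=> i _; apply: measurableI; first apply: measurableC.
- by apply: (half i (a 0 i)) => x /=; [exact: ltW|move/negP; rewrite -leNgt].
- by apply: (half i (b 0 i)) => x /=; [|move/negP; rewrite -ltNge; exact: ltW].
Qed.

(** * The Euclidean norm *)

Lemma enorm_ge0 (R : realType) (n : nat) (x : 'rV[R]_n) : 0 <= enorm x.
Proof. exact: sqrtr_ge0. Qed.

Lemma coord_le_enorm (R : realType) (n : nat) (x : 'rV[R]_n) (i : 'I_n) :
  `|x 0 i| <= enorm x.
Proof.
rewrite -sqrtr_sqr ler_wsqrtr// (bigD1 i)//= lerDl.
by apply: sumr_ge0 => j _; exact: sqr_ge0.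
Qed.

Lemma normr_le_coord (R : realType) (n : nat) (x : 'rV[R]_n) (r : R) :
  0 <= r -> (`|x| <= r <-> forall i, `|x 0 i| <= r).
Proof.
move=> r0; rewrite [`|x|]mx_normrE; split=> [+ i|H].
  by apply: le_trans; rewrite (le_bigmax _ _ (0, i)).
by apply: bigmax_le => // -[i j] _ /=; rewrite ord1.
Qed.

Lemma normr_le_enorm (R : realType) (n : nat) (x : 'rV[R]_n) : `|x| <= enorm x.
Proof. by apply/normr_le_coord => [|i]; [exact: enorm_ge0|exact: coord_le_enorm]. Qed.

Lemma enorm_sqr (R : realType) (n : nat) (x : 'rV[R]_n) :
  enorm x ^+ 2 = \sum_i x 0 i ^+ 2.
Proof. by rewrite sqr_sqrtr// sumr_ge0// => i _; exact: sqr_ge0. Qed.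

Lemma enormZ (R : realType) (n : nat) (a : R) (x : 'rV[R]_n) :
  enorm (a *: x) = `|a| * enorm x.
Proof.
rewrite -sqrtr_sqr /enorm -sqrtrM ?sqr_ge0// mulr_sumr.
by congr Num.sqrt; apply: eq_bigr => i _; rewrite mxE exprMn.
Qed.

(** Cauchy-Schwarz: with [a] and [b] the norms of [x] and [y], the sum of squares
    of [b x_i - a y_i] is [2ab] times the defect of the inequality. *)
Lemma enorm_dot_le (R : realType) (n : nat) (x y : 'rV[R]_n) :
  \sum_i x 0 i * y 0 i <= enorm x * enorm y.
Proof.
have [x0|x0] := eqVneq (enorm x) 0.
  rewrite x0 mul0r big1// => i _; have := coord_le_enorm x i.
  by rewrite x0 normr_le0 => /eqP ->; rewrite mul0r.
have [y0|y0] := eqVneq (enorm y) 0.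
  rewrite y0 mulr0 big1// => i _; have := coord_le_enorm y i.
  by rewrite y0 normr_le0 => /eqP ->; rewrite mulr0.
have p0 : 0 < enorm x * enorm y *+ 2.
  by rewrite mulrn_wgt0// mulr_gt0// lt_neqAle eq_sym ?x0 ?y0 enorm_ge0.
rewrite -subr_ge0 -(pmulr_rge0 _ p0).
have -> : enorm x * enorm y *+ 2 * (enorm x * enorm y - \sum_i x 0 i * y 0 i) =
    \sum_i (enorm y * x 0 i - enorm x * y 0 i) ^+ 2.
  transitivity (enorm y ^+ 2 * (\sum_i x 0 i ^+ 2) + enorm x ^+ 2 * (\sum_i y 0 i ^+ 2)
     - enorm x * enorm y *+ 2 * (\sum_i x 0 i * y 0 i)).
    by rewrite -!enorm_sqr; ring.
  rewrite !mulr_sumr -big_split -sumrB /=; apply: eq_bigr => i _; ring.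
by apply: sumr_ge0 => i _; exact: sqr_ge0.
Qed.

Lemma enormD (R : realType) (n : nat) (x y : 'rV[R]_n) :
  enorm (x + y) <= enorm x + enorm y.
Proof.
rewrite -(@ler_pXn2r _ 2%N) ?nnegrE ?addr_ge0 ?enorm_ge0//.
rewrite sqrrD !enorm_sqr.
have -> : \sum_i (x + y) 0 i ^+ 2 =
    \sum_i x 0 i ^+ 2 + (\sum_i x 0 i * y 0 i) *+ 2 + \sum_i y 0 i ^+ 2.
  by rewrite -sumrMnl -!big_split /=; apply: eq_bigr => i _; rewrite mxE sqrrD.
by rewrite lerD2r lerD2l lerMn2r/= enorm_dot_le.
Qed.

Lemma enorm0 (R : realType) (n : nat) : enorm (0 : 'rV[R]_n) = 0.
Proof. by have := enormZ 0 (0 : 'rV[R]_n); rewrite scaler0 normr0 mul0r. Qed.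

Lemma enorm_sum_le (R : realType) (n : nat) (I : finType) (F : I -> 'rV[R]_n) :
  enorm (\sum_i F i) <= \sum_i enorm (F i).
Proof.
elim/big_ind2: _ => [|x1 x2 y1 y2 h1 h2|//]; first by rewrite enorm0.
by apply: le_trans (enormD _ _) _; apply: lerD.
Qed.

Lemma enorm_le_normr (R : realType) (n : nat) (x : 'rV[R]_n) :
  enorm x <= n%:R * `|x|.
Proof.
have xi i : `|x 0 i| <= `|x|.
  by have /(normr_le_coord _ (normr_ge0 _)) := lexx `|x|.
rewrite -(@ler_pXn2r _ 2%N) ?nnegrE ?mulr_ge0 ?enorm_ge0// enorm_sqr.
apply: (@le_trans _ _ (\sum_(i < n) `|x| ^+ 2)).
  by apply: ler_sum => i _; rewrite -real_normK ?num_real// lerXn2r ?nnegrE.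
have -> : \sum_(i < n) `|x| ^+ 2 = n%:R * `|x| ^+ 2.
  by rewrite sumr_const card_ord mulr_natl.
rewrite exprMn; apply: ler_wpM2r; first exact: sqr_ge0.
by rewrite -natrX ler_nat; case: (n) => // k; rewrite expnS leq_pmulr// expn_gt0.
Qed.

Lemma enorm_dist_le_ediam (R : realType) (n : nat) (A : set 'rV[R]_n) x y :
  A x -> A y -> ((enorm (x - y))%:E <= ediam A)%E.
Proof. by move=> Ax Ay; apply: ereal_sup_ubound; exists (x, y). Qed.

Lemma eball_open (R : realType) (n : nat) (c y : 'rV[R]_n.+1) (r : R) :
  eball c r y -> \forall z \near y, eball c r z.
Proof.
move=> /= yr; apply/nbhs_ballP; pose e := (r - enorm (y - c)) / n.+1%:R.
exists e; first by rewrite /= divr_gt0// subr_gt0.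
move=> z; rewrite -ball_normE /= distrC /e ltr_pdivlMr// => zy.
rewrite /eball /=; have -> : z - c = (z - y) + (y - c) by rewrite addrA subrK.
apply: le_lt_trans (enormD _ _) _; rewrite -ltrBrDr; apply: le_lt_trans zy.
by rewrite mulrC; exact: enorm_le_normr.
Qed.

(** * Hausdorff measures *)

(** Caratheodory's criterion, for the sublevel set [C] of a function [phi] that
    stands for the distance to [C]. In a test set [X] of finite measure the shells
    [S k], where [phi] lies between [1 / (k + 2)] and [1 / (k + 1)], are
    separated when they are not adjacent, so their measures have a finite sum;
    hence removing from [X] minus [C] the points where [phi] is small loses only
    the tail of a convergent series, and what is left is separated from [C]. *)
Lemma separated_caratheodory (R : realType) (T : Type)
    (mu : {outer_measure set T -> \bar R}) (phi : T -> R) :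
  (forall (A B : set T) (e : R), 0 < e ->
     (forall x y, A x -> B y -> e <= phi y - phi x) ->
     (mu A + mu B <= mu (A `|` B))%E) ->
  mu.-caratheodory [set x | phi x <= 0].
Proof.
move=> sep; apply: le_caratheodory_measurable => X; set C := [set x | _].
have [->|] := eqVneq (mu X) +oo%E; first by rewrite leey.
rewrite -ltey => Xfin.
pose e k : R := k.+1%:R^-1.
have e_gt0 k : 0 < e k by rewrite invr_gt0.
have e_lt k l : (k < l)%N -> e l < e k.
  by move=> kl; rewrite ltf_pV2 ?posrE// ltr_nat ltnS.
have e_le k l : (k <= l)%N -> e l <= e k.
  by rewrite leq_eqVlt => /orP[/eqP->//|/e_lt/ltW].
have sub A : A `<=` X -> (mu A <= mu X)%E by exact: le_outer_measure.
pose D n := X `&` [set x | e n <= phi x].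
pose S k := X `&` [set x | e k.+1 <= phi x < e k].
have S0 k : (0 <= mu (S k))%E by exact: outer_measure_ge0.
(* S (n + 1) lies below 1 / (n + 2) and D n above 1 / (n + 1) *)
have step n : (mu (S n.+1) + mu (D n) <= mu (D n.+2))%E.
  apply: le_trans (sep _ _ (e n - e n.+1) _ _) _.
  - by rewrite subr_gt0 e_lt.
  - by move=> x y [_ /= /andP[_ xn]] [_ /= ny]; apply: lerB => //; exact: ltW.
  apply: le_outer_measure => x [[Xx /= /andP[? _]]|[Xx /= nx]]; split=> //=.
  by apply: le_trans nx; apply/ltW/e_lt.
have partial n : (\sum_(0 <= k < n.+1) mu (S k) <= mu (D n) + mu (D n.+1))%E.
  elim: n => [|n IH].
    rewrite big_nat1 -[leLHS]add0e; apply: leeD; first exact: outer_measure_ge0.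
    by apply: le_outer_measure => x [Xx /= /andP[? _]]; split.
  rewrite big_nat_recr//= addeC.
  apply: le_trans (leeD (lexx _) IH) _.
  by rewrite addeA addeC; apply: leeD; [exact: lexx|exact: step].
have Sfin : (\sum_(k <oo) mu (S k) < +oo)%E.
  apply: (@le_lt_trans _ _ (mu X + mu X)%E); last by rewrite lte_add_pinfty.
  apply: lime_le; first exact: is_cvg_nneseries.
  near=> n; apply: (@le_trans _ _ (\sum_(0 <= k < n.+1) mu (S k))%E).
    by rewrite big_nat_recr//= leeDl.
  apply: le_trans (partial n) _; apply: leeD; apply: sub; exact: subIsetl.
have tail n : (mu (X `&` C) + mu (X `&` ~` C) <=
    mu X + \sum_(n <= k <oo) mu (S k))%E.
  have cov : X `&` ~` C `<=` D n `|` \bigcup_k S (k + n)%N.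
    move=> x [Xx /= /negP]; rewrite -ltNge => x0.
    have [nx|xn] := leP (e n) (phi x); [by left; split|right].
    have ex : exists k, e k <= phi x.
      have [k] := ltr_add_invr x0; rewrite add0r => kx; exists k; exact: ltW.
    (* x lies in S k if k + 1 is the first index with e (k + 1) <= phi x *)
    case: (ex_minnP ex) => -[|k] kx kmin.
      by have := lt_le_trans xn (le_trans (e_le _ _ (leq0n n)) kx); rewrite ltxx.
    have xk : phi x < e k by rewrite ltNge; apply/negP => /kmin; rewrite ltnn.
    have nk : (n <= k)%N.
      rewrite leqNgt; apply/negP => /e_le kn.
      by have := le_lt_trans (le_trans kn kx) xn; rewrite ltxx.
    by exists (k - n)%N => //; rewrite subnK//; split=> //=; rewrite kx xk.
  have := le_outer_measure mu _ _ cov.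
  move=> /le_trans/(_ (outer_measureU2 _ _ _)) H.
  apply: le_trans (leeD (lexx _) H) _; rewrite addeA; apply: leeD.
    apply: le_trans (sep _ _ (e n) _ _) _ => //.
    - move=> x y [_ /= x0] [_ /= ny]; rewrite lerBrDl.
      by apply: le_trans ny; rewrite gerDr.
    - by apply: sub => x [] [].
  apply: le_trans (outer_measure_sigma_subadditive _ _) _.
  by rewrite (@nneseries_addn _ (fun k => mu (S k))).
have H := nneseries_tail_cvg Sfin (fun k _ => S0 k).
have : (mu X + \sum_(N <= k <oo) mu (S k))%E @[N --> \oo] --> (mu X + 0)%E.
  apply: cvgeD => //; [exact: fin_num_adde_defl|exact: cvg_cst].
by rewrite adde0 => /cvge_to_ge; apply; exact: nearW.
Unshelve. all: by end_near. Qed.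

Lemma unit_ball_volume_gt0 (R : realType) k : 0 < unit_ball_volume k :> R.
Proof.
suff: 0 < unit_ball_volume k :> R /\ 0 < unit_ball_volume k.+1 :> R by case.
elim: k => [|k [h0 h1]]; first by split=> /=.
by split=> //=; rewrite mulr_gt0// divr_gt0// mulr_gt0// pi_gt0.
Qed.

Lemma hausdorff_weight_ge0 (R : realType) (n s : nat) delta (A : set 'rV[R]_n) :
  (0 <= hausdorff_weight s delta A)%E.
Proof.
rewrite /hausdorff_weight; case: eqVneq => // /eqP/eqP/set0P[x Ax].
case: ifP => // _; rewrite lee_fin mulr_ge0 ?exprn_ge0 ?divr_ge0//.
  exact/ltW/unit_ball_volume_gt0.
apply: fine_ge0; apply: le_trans (enorm_dist_le_ediam Ax Ax).
by rewrite lee_fin enorm_ge0.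
Qed.

Lemma hausdorff_weightP (R : realType) (n s : nat) delta (A : set 'rV[R]_n) :
  [\/ A = set0, hausdorff_weight s delta A = +oo%E |
    A !=set0 /\ exists2 D, ediam A = D%:E & [/\ 0 <= D, D <= delta &
      hausdorff_weight s delta A = (unit_ball_volume s * (D / 2) ^+ s)%:E]].
Proof.
have [->|A0] := eqVneq A set0; first by constructor 1.
have [Ad|Ad] := boolP (ediam A <= delta%:E)%E; last first.
  by constructor 2; rewrite /hausdorff_weight (negPf A0) (negPf Ad).
constructor 3; have /set0P[x Ax] := A0; split; first exact/set0P.
have D0 : (0 <= ediam A)%E.
  by apply: le_trans (enorm_dist_le_ediam Ax Ax); rewrite lee_fin enorm_ge0.
have Dfin : ediam A \is a fin_num.
  by rewrite ge0_fin_numE//; apply: le_lt_trans Ad _; rewrite ltry.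
exists (fine (ediam A)); first by rewrite fineK.
split; rewrite ?fine_ge0//; first by rewrite -lee_fin fineK.
by rewrite /hausdorff_weight (negPf A0) Ad.
Qed.

Lemma hausdorff_weight_set0 (R : realType) (n s : nat) delta :
  hausdorff_weight s delta (@set0 'rV[R]_n) = 0%E.
Proof. by rewrite /hausdorff_weight eqxx. Qed.

Lemma hausdorff_weight_le (R : realType) (n s : nat) (delta delta' : R)
    (A : set 'rV[R]_n) :
  delta <= delta' -> (hausdorff_weight s delta' A <= hausdorff_weight s delta A)%E.
Proof.
move=> dd; rewrite /hausdorff_weight; case: ifP => // _.
case: ifPn => [Ad'|Ad']; case: ifPn => // Ad; first by rewrite leey.
case/negP: Ad'; apply: le_trans Ad _; by rewrite lee_fin.
Qed.

(** A set of diameter less than [e] meets at most one of [A] and [B], so at fine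
    scales a cover of the union is made of a cover of each. *)
Lemma hausdorff_separated (R : realType) (n s : nat) (A B : set 'rV[R]_n) (e : R) :
  0 < e -> (forall x y, A x -> B y -> e <= enorm (x - y)) ->
  (hausdorff s A + hausdorff s B <= hausdorff s (A `|` B))%E.
Proof.
move=> e0 sep.
have key delta : 0 < delta -> delta < e ->
    (cover_outer (hausdorff_weight s delta) A +
     cover_outer (hausdorff_weight s delta) B <= hausdorff s (A `|` B))%E.
  move=> d0 de; apply: (@le_trans _ _ (cover_outer (hausdorff_weight s delta) (A `|` B))).
    have := @cover_outer_split _ _ (hausdorff_weight s delta) A B (A `|` B).
    rewrite (setIidr (@subsetUl _ A B)) (setIidr (@subsetUr _ A B)).
    apply=> S; first exact: hausdorff_weight_ge0.
    have [->|Soo|[_ [D DE [_ Dd _]]]] := hausdorff_weightP s delta S.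
    - by exists set0, set0; rewrite !set0I hausdorff_weight_set0 adde0; split.
    - by exists S, S; rewrite Soo leey; split=> // x [].
    - have [SA|/set0P[x [Sx Ax]]] := eqVneq (S `&` A) set0.
        exists set0, S; rewrite SA hausdorff_weight_set0 add0e; split=> //.
      exists S, set0; rewrite hausdorff_weight_set0 adde0; split=> //.
      move=> y [Sy By]; have := enorm_dist_le_ediam Sx Sy.
      rewrite DE lee_fin => /le_trans/(_ Dd)/(le_trans (sep _ _ Ax By)).
      by rewrite leNgt de.
  by apply: ereal_sup_ubound; exists delta.
have mono (C : set 'rV[R]_n) d d' : d <= d' ->
    (cover_outer (hausdorff_weight s d') C <=
     cover_outer (hausdorff_weight s d) C)%E.
  move=> dd; apply: le_ereal_inf_tmp => _ [F /= CF <-].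
  apply: le_trans (cover_outer_le _ CF) _.
  apply: lee_nneseries => *; first exact: hausdorff_weight_ge0.
  exact: hausdorff_weight_le.
have [->|] := eqVneq (hausdorff s (A `|` B)) +oo%E; first by rewrite leey.
rewrite -ltey => fin.
have finS C : C `<=` A `|` B -> hausdorff s C \is a fin_num.
  move=> CAB; rewrite ge0_fin_numE; last exact: (outer_measure_ge0 (hausdorff s)).
  by apply: le_lt_trans fin; apply: (le_outer_measure (hausdorff s)).
have fA : hausdorff s A \is a fin_num by apply: finS; exact: subsetUl.
have fB : hausdorff s B \is a fin_num by apply: finS; exact: subsetUr.
have le_h (C : set 'rV[R]_n) d : 0 < d ->
    (cover_outer (hausdorff_weight s d) C <= hausdorff s C)%E.
  by move=> d0; apply: ereal_sup_ubound; exists d.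
rewrite -leeBrDr//; apply: ge_ereal_sup => _ [d /= d0 <-].
have fd : cover_outer (hausdorff_weight s d) A \is a fin_num.
  rewrite ge0_fin_numE; last first.
    by apply: cover_outer_ge0 => C; exact: hausdorff_weight_ge0.
  by apply: le_lt_trans (le_h _ _ d0) _; rewrite ltey_eq fA.
rewrite leeBrDr// addeC -leeBrDr//; apply: ge_ereal_sup => _ [d' /= d'0 <-].
rewrite leeBrDr// addeC.
(* the two parts may be measured at different scales; m is finer than both *)
pose m := Num.min (Num.min d d') (e / 2).
have m0 : 0 < m by rewrite !lt_min d0 d'0 divr_gt0.
apply: le_trans (key m m0 _); last first.
  by rewrite !gt_min ltr_pdivrMr// mulr2n mulrDr mulr1 ltrDl e0 !orbT.
by apply: leeD; apply: mono; rewrite !ge_min lexx ?orbT.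
Qed.

(** The distance to [A] is taken in the sup norm: it is 1-Lipschitz for the
    Euclidean norm as well, which is all that separation needs. *)
Lemma closed_caratheodory (R : realType) (n s : nat) (A : set 'rV[R]_n) :
  closed A -> (hausdorff s).-caratheodory A.
Proof.
move=> cA; have [->|/set0P[z0 Az0]] := eqVneq A set0.
  exact: (@measurable0 _ (caratheodory_type (@hausdorff R n s))).
pose E (x : 'rV[R]_n) := [set `|x - z| | z in A].
pose phi x := inf (E x).
have E0 x : E x !=set0 by exists `|x - z0|, z0.
have lbE x : lbound (E x) 0 by move=> _ [z _ <-].
have phi_le x z : A z -> phi x <= `|x - z|.
  by move=> Az; apply: ge_inf; [exists 0; exact: lbE|exists z].
have phi_lip x y : phi y - phi x <= enorm (x - y).
  apply: le_trans (normr_le_enorm _); rewrite lerBlDr -lerBlDl.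
  apply: lb_le_inf => // _ [z Az <-]; rewrite lerBlDl.
  by apply: le_trans (phi_le y z Az) _; rewrite [`|x - y|]distrC; exact: ler_distD.
have -> : A = [set x | phi x <= 0].
  apply/seteqP; split=> [x Ax|x /= x0].
    by have := phi_le x x Ax; rewrite subrr normr0.
  apply: cA => U /nbhs_ballP[e /= e0 eU].
  have [_ [z Az <-] ze] := inf_lt (E0 x) (le_lt_trans x0 e0).
  by exists z; split=> //; apply: eU; rewrite -ball_normE.
apply: separated_caratheodory => B C e e0 sep.
apply: (@hausdorff_separated R n s B C e e0) => x y Bx Cy.
by apply: le_trans (phi_lip x y); exact: sep.
Qed.

(** A set of diameter [D] projects into a cube of side [2 D] centered at the
    projection of any of its points. Its weight is a fixed multiple of the volume
    of that cube, and the cubes cover [box u v]. *)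
Lemma hausdorff_projection_ge (R : realType) (n : nat) (j : 'I_n.+1)
    (A : set 'rV[R]_n.+1) (u v : 'rV[R]_n) :
  (forall i, u 0 i <= v 0 i) ->
  (forall z, box u v z -> exists2 y, A y & col' j y = z) ->
  ((unit_ball_volume n / 4 ^+ n * \prod_i (v 0 i - u 0 i))%:E
   <= hausdorff n A)%E.
Proof.
move=> uv proj.
apply: (@le_trans _ _ (cover_outer (hausdorff_weight n 1) A)); last first.
  by apply: ereal_sup_ubound; exists 1 => //=.
apply: le_ereal_inf_tmp => _ [F /= cover <-].
have w0 k : (0 <= hausdorff_weight n 1 (F k))%E by exact: hausdorff_weight_ge0.
have [[k Fk]|finF] := pselect (exists k, hausdorff_weight n 1 (F k) = +oo%E).
  by rewrite (@nneseries_pinfty _ _ _ k) ?leey.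
have /choice[z /choice[D FE]] : forall k, exists (z : 'rV[R]_n.+1) (D : R),
    F k !=set0 -> [/\ F k z, ediam (F k) = D%:E, 0 <= D &
      hausdorff_weight n 1 (F k) = (unit_ball_volume n * (D / 2) ^+ n)%:E].
  move=> k; have [->|Fk|[[z Fz] [D DE [D0 _ wE]]]] := hausdorff_weightP n 1 (F k).
  - by exists 0, 0 => -[].
  - by case: finF; exists k.
  - by exists z, D.
pose P k := `[< F k !=set0 >].
pose a k := col' j (z k) - const_mx (D k).
pose b k := col' j (z k) + const_mx (D k).
have := @box_cover_volume R n u v P a b uv.
have ab k i : b k 0 i - a k 0 i = D k * 2.
  by rewrite !mxE; ring.
move=> /(_ _ _)/(le_trans _) H.
have c0 : 0 <= unit_ball_volume n / 4 ^+ n :> R.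
  by rewrite divr_ge0 ?exprn_ge0//; exact/ltW/unit_ball_volume_gt0.
rewrite EFinM; apply: (@le_trans _ _ ((unit_ball_volume n / 4 ^+ n)%:E *
   \sum_(k <oo | P k) (\prod_i (b k 0 i - a k 0 i))%:E)%E).
  apply: lee_wpmul2l; first by rewrite lee_fin.
  apply: H => //.
  - move=> k /asboolP/FE[_ _ D0 _] i.
    by rewrite -subr_ge0 ab mulr_ge0.
  - move=> x /proj[y Ay yx]; have [k _ Fy] := cover y Ay.
    have Fk : F k !=set0 by exists y.
    exists k; first exact/asboolP.
    have [Fz DE D0 _] := FE k Fk.
    move=> i; rewrite -yx !mxE.
    have := enorm_dist_le_ediam Fy Fz; rewrite DE lee_fin.
    move=> /(le_trans (coord_le_enorm _ (lift j i))); rewrite !mxE ler_distl.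
    by rewrite addrC.
rewrite -nneseriesZl; last first.
  move=> k /asboolP/FE[_ _ D0 _]; rewrite lee_fin; apply: prodr_ge0 => i _.
  by rewrite ab mulr_ge0.
rewrite eseries_mkcond; apply: lee_nneseries => [k _ _|k _]; case: ifPn => //.
- move=> /asboolP/FE[_ _ D0 _]; rewrite -EFinM lee_fin mulr_ge0// prodr_ge0//.
  by move=> i _; rewrite ab mulr_ge0.
- move=> /asboolP/FE[_ _ D0 ->]; rewrite -EFinM lee_fin.
  under eq_bigr do rewrite ab.
  rewrite prodr_const card_ord -mulrA; apply: ler_wpM2l.
    exact/ltW/unit_ball_volume_gt0.
  rewrite -exprVn -exprMn; have -> // : 4^-1 * (D k * 2) = D k / 2 by field.
Qed.

(** * The area of a smooth surface in small balls *)

Lemma is_derive_line (R : realType) (V : normedModType R) (f : V -> R)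
    (x v : V) (s : R) :
  derivable f (s *: v + x) v ->
  is_derive s 1 (fun t : R => f (t *: v + x)) ('D_v f (s *: v + x)).
Proof.
have E : (fun h : R => h^-1 *: (f ((h *: (1 : R) + s) *: v + x) - f (s *: v + x))) =
         (fun h : R => h^-1 *: (f (h *: v + (s *: v + x)) - f (s *: v + x))).
  apply/funext => h; rewrite scalerDl -addrA.
  by have -> : h *: (1 : R) = h by exact: mulr1.
move=> dfx; apply: DeriveDef; first by rewrite /derivable /= E.
by rewrite /derive /= E.
Qed.

Lemma line_mean_value (R : realType) (V : normedModType R) (f : V -> R) (x v : V)
    (a b M : R) :
  (forall s, Num.min a b <= s <= Num.max a b ->
     derivable f (s *: v + x) v /\ `|'D_v f (s *: v + x)| <= M) ->
  `|f (b *: v + x) - f (a *: v + x)| <= M * `|b - a|.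
Proof.
wlog ab : a b / a <= b => [wlg|].
  case/orP: (le_total a b) => [/wlg//|/wlg H K].
  by rewrite distrC (distrC b); apply: H => s; rewrite minC maxC; exact: K.
rewrite (min_idPl ab) (max_idPr ab) => H.
pose phi (t : R) := f (t *: v + x).
have dphi s : s \in `[a, b] -> is_derive s 1 phi ('D_v f (s *: v + x)).
  by rewrite in_itv => /H[dfs _]; exact: is_derive_line.
have cphi : {within `[a, b], continuous phi}.
  by apply: derivable_within_continuous => s /dphi[].
have dphi' s : s \in `]a, b[ -> is_derive s 1 phi ('D_v f (s *: v + x)).
  by move=> /subset_itv_oo_cc; exact: dphi.
have [c cab E] := MVT_segment ab dphi' cphi.
rewrite -/(phi b) -/(phi a) E normrM ler_wpM2r//.
by move: cab; rewrite in_itv => /H[].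
Qed.

(** The partial derivatives are bounded near [x0]; the points [z k], which take
    their first [k] coordinates from [y] and the others from [x], lead from [x] to
    [y] along the axes, and each step obeys the mean value theorem. *)
Lemma C1_locally_lipschitz (R : realType) (n : nat) (g : 'rV[R]_n -> R)
    (x0 : 'rV[R]_n) :
  Ck 1 g -> exists2 L, 0 <= L & exists2 rho, 0 < rho &
    forall x y, `|x - x0| <= rho -> `|y - x0| <= rho ->
    `|g y - g x| <= L * `|y - x|.
Proof.
move=> [_ Cg]; pose D i (x : 'rV[R]_n) : R := 'D_(delta_mx 0 i) g x.
pose M := 1 + \sum_i `|D i x0|.
have M0 : 0 <= M by rewrite addr_ge0// sumr_ge0.
have : \forall x \near x0, forall i : 'I_n, `|D i x| < M.
  apply: (@filter_forall _ _ (fun i => [set x | `|D i x| < M]) (nbhs x0)) => i.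
  have [_ [cD _]] := Cg i.
  have cDi : D i x @[x --> x0] --> D i x0 by exact: (cD x0).
  have cND : `|D i x| @[x --> x0] --> `|D i x0| by exact: cvg_norm cDi.
  apply: (cvgr_lt _ cND); rewrite /M (bigD1 i)//= addrCA ltrDl.
  by rewrite ltr_wpDr// sumr_ge0.
move=> /nbhs_ballP[e /= e0 eM].
have MD x i : `|x - x0| <= e / 2 -> `|D i x| <= M.
  move=> xe; apply/ltW/eM; rewrite -ball_normE /= distrC.
  by apply: le_lt_trans xe _; rewrite ltr_pdivrMr// mulr2n mulrDr mulr1 ltrDl.
have e20 : 0 < e / 2 by rewrite divr_gt0.
exists (M *+ n); first by rewrite mulrn_wge0.
exists (e / 2) => // x y.
move=> /(normr_le_coord _ (ltW e20)) xe /(normr_le_coord _ (ltW e20)) ye.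
pose z k : 'rV[R]_n := \row_j if (j < k)%N then y 0 j else x 0 j.
have -> : g y - g x = \sum_(0 <= k < n) (g (z k.+1) - g (z k)).
  rewrite telescope_sumr//; congr (g _ - g _).
    by apply/rowP => j; rewrite mxE ltn_ord.
  by apply/rowP => j; rewrite mxE.
rewrite big_mkord; apply: le_trans (ler_norm_sum _ _ _) _.
have -> : M *+ n * `|y - x| = \sum_(i < n) M * `|y - x|.
  by rewrite mulrnAl sumr_const card_ord.
apply: ler_sum => k _.
apply: (@le_trans _ _ (M * `|y 0 k - x 0 k|)); last first.
  apply: ler_wpM2l => //.
  have := @normr_le_coord R n (y - x) `|y - x| (normr_ge0 _).
  by case=> /(_ (lexx _))/(_ k); rewrite !mxE.
pose w : 'rV[R]_n := \row_j if j == k then 0 else z k 0 j.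
have zE (s : R) j : (s *: delta_mx 0 k + w) 0 j = if j == k then s else z k 0 j.
  by rewrite !mxE eqxx/=; case: eqP => _; rewrite ?mulr1 ?addr0 ?mulr0 ?add0r.
have -> : z k.+1 = y 0 k *: delta_mx 0 k + w.
  apply/rowP => j; rewrite zE !mxE; case: eqP => [->|]; first by rewrite ltnSn.
  by move=> jk; rewrite ltnS leq_eqVlt; case: eqP => // /val_inj.
have -> : z k = x 0 k *: delta_mx 0 k + w.
  by apply/rowP => j; rewrite zE !mxE; case: eqP => [->|//]; rewrite ltnn.
apply: line_mean_value => s sxy; split; first by have [] := Cg k.
apply: MD; apply/normr_le_coord => [|j]; first exact: ltW.
rewrite mxE zE mxE; case: eqP => [->|_].
  have := xe k; have := ye k; rewrite !mxE !ler_distl => yk xk.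
  move: sxy yk xk; rewrite ge_min le_max => /andP[/orP[]h1 /orP[]h2];
  move=> /andP[? ?] /andP[? ?];
  apply/andP; split; lra.
by rewrite mxE; case: ifP => _; [have := ye j|have := xe j]; rewrite !mxE.
Qed.

(** Near [x0] the surface is the graph of an [L]-Lipschitz function, so the part of
    it in the ball of radius [r] around [x] projects onto the whole cube of
    half-side [r / (1 + L)] around the projection of [x]. *)
Lemma C2_graph_measure_ge (R : realType) (n : nat) (Gamma : set 'rV[R]_n.+1)
    (x0 : 'rV[R]_n.+1) :
  C2_smooth Gamma -> Gamma x0 ->
  exists2 c, 0 < c & exists2 rho, 0 < rho &
    forall x r, Gamma x -> `|x - x0| <= rho -> 0 < r -> r <= rho ->
    ((c * r ^+ n)%:E <= hausdorff n (Gamma `&` [set y | (`|y - x| <= r)%R]))%E.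
Proof.
move=> C2 Gx0; have [j [g [Cg graph]]] := C2 x0 Gx0.
have {Cg} C1 : Ck 1 g.
  by case: Cg => cg Cg; split=> // i; have [? [? _]] := Cg i; split=> //; split.
have [L L0 [e e0 lip]] := C1_locally_lipschitz (col' j x0) C1.
have /nbhs_ballP[e' /= e'0 nearG] := graph.
(* two radii of length rho must fit where the graph and its Lipschitz bound hold *)
pose rho := Num.min e e' / 4.
have m0 : 0 < Num.min e e' by rewrite lt_min e0 e'0.
have rho0 : 0 < rho by rewrite divr_gt0.
have rhoe : rho *+ 2 <= e.
  by apply: le_trans (_ : Num.min e e' <= _); rewrite ?ge_min ?lexx// /rho; lra.
have rhoe' : rho *+ 2 < e'.
  by apply: lt_le_trans (_ : Num.min e e' <= _); rewrite ?ge_min ?lexx ?orbT// /rho; lra.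
have L1 : 0 < 1 + L by rewrite ltr_pwDl.
exists (unit_ball_volume n / 4 ^+ n * (2 / (1 + L)) ^+ n).
  by rewrite !mulr_gt0 ?invr_gt0 ?exprn_gt0 ?unit_ball_volume_gt0// divr_gt0.
exists rho => // x r Gx xx0 r0 r_rho.
pose r' := r / (1 + L).
have r'0 : 0 < r' by rewrite divr_gt0.
have r'r : r' <= r by rewrite ler_pdivrMr// ler_peMr ?lerDl// ltW.
have Lr' : L * r' <= r.
  by rewrite mulrA ler_pdivrMr// mulrC ler_wpM2l ?ltW// ltrDr.
have inG y : `|y - x0| <= rho *+ 2 -> Gamma y <-> y 0 j = g (col' j y).
  move=> yx0; apply: nearG; rewrite -ball_normE /= distrC.
  exact: le_lt_trans yx0 _.
have col_le (y y' : 'rV[R]_n.+1) s : 0 <= s -> `|y - y'| <= s ->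
    `|col' j y - col' j y'| <= s.
  move=> s0 /(normr_le_coord _ s0) ys; apply/normr_le_coord => // i.
  by have := ys (lift j i); rewrite !mxE.
have xj : x 0 j = g (col' j x).
  by apply/inG => //; apply: le_trans xx0 _; rewrite lerDl ltW.
have me2 (s : R) : s <= rho + rho -> s <= e by lra.
pose u := col' j x - const_mx r'; pose v := col' j x + const_mx r'.
have uv i : v 0 i - u 0 i = r' * 2 by rewrite !mxE; ring.
have := @hausdorff_projection_ge R n j (Gamma `&` [set y | `|y - x| <= r]) u v.
under eq_bigr do rewrite uv.
rewrite prodr_const card_ord => H.
have -> : unit_ball_volume n / 4 ^+ n * (2 / (1 + L)) ^+ n * r ^+ n =
    unit_ball_volume n / 4 ^+ n * (r' * 2) ^+ n :> R.
  rewrite -mulrA -exprMn; congr (_ * _ ^+ _); rewrite /r'; ring.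
apply: H => [i|z zB]; first by rewrite -subr_ge0 uv mulr_ge0// ltW.
have zx : `|z - col' j x| <= r'.
  apply/normr_le_coord => [|i]; first exact: ltW.
  by have := zB i; rewrite !mxE ler_distl.
(* the point of the graph above z *)
pose y : 'rV[R]_n.+1 := \row_k if unlift j k is Some i then z 0 i else g z.
have yz : col' j y = z by apply/rowP => i; rewrite !mxE liftK.
have yj : y 0 j = g z by rewrite mxE unlift_none.
have yx : `|y - x| <= r.
  apply/normr_le_coord => [|k]; first exact: ltW.
  rewrite mxE [(- x) 0 k]mxE; case: (unliftP j k) => [i ->|->].
    have /normr_le_coord := zx => /(_ (ltW r'0))/(_ i).
    rewrite !mxE liftK; move/le_trans; exact.
  rewrite yj xj; apply: le_trans (lip _ _ _ _) _.
  - by apply: col_le; [exact: ltW|apply: le_trans xx0 _; lra].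
  - have -> : z - col' j x0 = (z - col' j x) + (col' j x - col' j x0).
      by rewrite addrA subrK.
    apply: le_trans (ler_normD _ _) _; apply: me2; apply: lerD.
      by apply: le_trans zx _; apply: le_trans r'r r_rho.
    by apply: col_le => //; exact: ltW.
  - by apply: le_trans Lr'; apply: ler_wpM2l.
exists y => //; split=> //; apply/inG; last by rewrite yj yz.
have -> : y - x0 = (y - x) + (x - x0) by rewrite addrA subrK.
by apply: le_trans (ler_normD _ _) _; apply: lerD => //; apply: le_trans yx _.
Qed.

(** One number [eps] serves as the constant and as the bound of the radii: the
    property only gets weaker when [eps] decreases, so that compactness applies in
    the form of near coverings with [eps] tending to 0. *)
Lemma C2_compact_measure_ge (R : realType) (n : nat) (Gamma : set 'rV[R]_n.+1) :
  C2_smooth Gamma -> compact Gamma ->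
  exists2 eps, 0 < eps &
    forall x r, Gamma x -> 0 < r -> r <= eps ->
    ((eps * r ^+ n)%:E <= hausdorff n (Gamma `&` [set y | (`|y - x| <= r)%R]))%E.
Proof.
move=> C2 /compact_near_coveringP.
pose P (eps : R) x := forall r, Gamma x -> 0 < r -> r <= eps ->
  ((eps * r ^+ n)%:E <= hausdorff n (Gamma `&` [set y | (`|y - x| <= r)%R]))%E.
move=> cov; have F : \forall eps \near (0 : R)^'+, Gamma `<=` P eps.
  apply: cov => x0 Gx0.
  have [c c0 [rho rho0 H]] := C2_graph_measure_ge C2 Gx0.
  have m0 : 0 < Num.min c rho by rewrite lt_min c0 rho0.
  near=> x eps => r Gx r0 re.
  have em : eps <= Num.min c rho by near: eps; exact: nbhs_right_le.
  move: em; rewrite le_min => /andP[ec er].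
  apply: le_trans (H x r Gx _ r0 (le_trans re er)).
    by rewrite lee_fin ler_wpM2r// exprn_ge0// ltW.
  near: x; apply/nbhs_ballP; exists rho => //= y; rewrite -ball_normE /= distrC.
  exact: ltW.
near (0 : R)^'+ => eps; exists eps => // x r Gx.
have PG : Gamma `<=` P eps by near: eps; exact: F.
exact: (PG x Gx r Gx).
Unshelve. all: by end_near. Qed.

(** * Bounds of norms of functions that need not be measurable *)

(** The integral of a nonnegative function is a supremum over the simple functions
    below it, hence is monotone without any measurability. *)
Lemma ge0_le_integral_nonmeasurable d (T : measurableType d) (R : realType)
    (mu : {measure set T -> \bar R}) (f g : T -> \bar R) :
  (forall x, 0 <= f x)%E -> (forall x, f x <= g x)%E ->
  (\int[mu]_x f x <= \int[mu]_x g x)%E.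
Proof.
move=> f0 fg; have g0 x : (0 <= g x)%E := le_trans (f0 x) (fg x).
rewrite !ge0_integralTE//; apply: ereal_sup_le => _ [h /= hf <-].
by exists h => //= x; exact: le_trans (hf x) (fg x).
Qed.

Lemma Lnorm_on_pinfty_le (R : realType) (T : pointedType)
    (mu : {outer_measure set T -> \bar R}) (A : set T) (f : T -> R) (t : \bar R) :
  (0 <= t)%E -> (forall x, A x -> (`|f x|%:E <= t)%E) ->
  (Lnorm_on mu +oo A f <= t)%E.
Proof.
move=> t0 ft; rewrite /Lnorm_on unlock; case: ifP => // _.
apply/ess_supP; apply: aeW => x; rewrite /= /patch; case: ifPn => [xA|_].
  by apply: ft; exact: set_mem.
by rewrite abse0.
Qed.

Lemma Lnorm_on_2_ge (R : realType) (T : pointedType)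
    (mu : {outer_measure set T -> \bar R}) (A E : set T) (f : T -> R) (t v : R) :
  0 <= t -> 0 <= v -> mu.-caratheodory E -> E `<=` A ->
  (forall x, E x -> t <= `|f x|) -> (v%:E <= mu E)%E ->
  ((t * Num.sqrt v)%:E <= Lnorm_on mu 2%:E A f)%E.
Proof.
move=> t0 v0 mE EA tf vE; rewrite /Lnorm_on unlock.
set I := (X in (_ <= X `^ _)%E).
have H : ((t ^+ 2 * v)%:E <= I)%E.
  rewrite EFinM; apply: (@le_trans _ _ ((t ^+ 2)%:E * mu E)%E).
    by apply: lee_wpmul2l; rewrite // lee_fin exprn_ge0.
  rewrite -(@integral_cst _ (caratheodory_type mu) R mu E mE) integral_mkcond.
  apply: ge0_le_integral_nonmeasurable => x; rewrite /patch; case: ifPn => xE //.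
  - by rewrite lee_fin exprn_ge0.
  - have Ex : E x by exact: set_mem.
    rewrite mem_set ?poweR_EFin /= ?lee_fin; last exact: EA.
    rewrite -powR_mulrn//; apply: ge0_ler_powR; rewrite ?nnegrE//.
    exact: tf.
  - exact: poweR_ge0.
apply: (@le_trans _ _ ((t ^+ 2 * v)%:E `^ 2^-1)%E).
  rewrite poweR_EFin lee_fin powR12_sqrt ?mulr_ge0 ?exprn_ge0//.
  by rewrite sqrtrM ?exprn_ge0// sqrtr_sqr ger0_norm.
apply: gt0_ler_poweR; rewrite ?invr_ge0// ?in_itv/= ?leey ?andbT//.
  by rewrite lee_fin mulr_ge0// exprn_ge0.
by apply: le_trans H; rewrite lee_fin mulr_ge0// exprn_ge0.
Qed.

(** * Polynomials on cubes *)

Lemma is_derive_coord (R : realType) (n : nat) (i : 'I_n) (x v : 'rV[R]_n) :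
  is_derive x v (fun y : 'rV[R]_n => y 0 i : R) (v 0 i).
Proof.
have E : (fun h : R => h^-1 *: ((h *: v + x) 0 i - x 0 i)) @ 0^' --> (v 0 i : R).
  apply: cvg_near_cst.
  near=> h; rewrite !mxE addrK /= /GRing.scale/= mulrA mulVf ?mul1r//.
  by near: h; exact: nbhs_dnbhs_neq.
apply: DeriveDef; last by apply: cvg_lim => //; exact: E.
by apply/cvg_ex; exists (v 0 i); exact: E.
Unshelve. all: by end_near. Qed.

(** Both sides are compatible with sums and products, so it suffices to treat
    constants and variables. *)
Lemma is_derive_meval (R : realType) (n : nat) (p : mpoly n R) (x v : 'rV[R]_n) :
  is_derive x v (fun y : 'rV[R]_n => meval (fun i => y 0 i) p)
    (\sum_i v 0 i * meval (fun i => x 0 i) (mderiv i p)).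
Proof.
pose Q p := forall x : 'rV[R]_n,
  is_derive x v (fun y : 'rV[R]_n => meval (fun i => y 0 i) p)
    (\sum_i v 0 i * meval (fun i => x 0 i) (mderiv i p)).
have QD p1 p2 : Q p1 -> Q p2 -> Q (p1 + p2).
  move=> h1 h2 y; have := is_deriveD (h1 y) (h2 y).
  rewrite -big_split /=; under [X in is_derive _ _ _ X -> _]eq_bigr do
    rewrite -mulrDr -mevalD -mderivD.
  by congr (is_derive _ _ _ _); apply/funext => z; rewrite mevalD.
have QM p1 p2 : Q p1 -> Q p2 -> Q (p1 * p2).
  move=> h1 h2 y; have := is_deriveM (h1 y) (h2 y).
  set A := (X in is_derive _ _ _ X -> _).
  have -> : A = \sum_i v 0 i * meval (fun i => y 0 i) (mderiv i (p1 * p2)).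
    rewrite /A /GRing.scale /= !mulr_sumr -big_split /=; apply: eq_bigr => i _.
    by rewrite mderivM mevalD !mevalM; ring.
  by congr (is_derive _ _ _ _); apply/funext => z; rewrite mevalM.
have QC c : Q (mpolyC n c).
  move=> y; have := is_derive_cst (c : R) y v.
  rewrite big1 => [|i _]; last by rewrite mderivC meval0 mulr0.
  by congr (is_derive _ _ _ _); apply/funext => z; rewrite mevalC.
have QX i : Q (mpolyX R (mnm1 i)).
  move=> y; have := is_derive_coord i y v.
  rewrite (bigD1 i)//= big1 => [|j ji]; last first.
    by rewrite mderivX mnm1E eq_sym (negPf ji) scale0r meval0 mulr0.
  rewrite mderivX mnm1E eqxx scale1r (_ : mnm_sub (mnm1 i) (mnm1 i) = mnm0); last first.
    by apply/mnmP => k; rewrite mnmBE subnn mnm0E.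
  rewrite mpolyX0 meval1 mulr1 addr0.
  by congr (is_derive _ _ _ _); apply/funext => z; rewrite mevalXU.
suff : Q p by apply.
elim/mpolyind: p => [|c m q _ _ IH]; first exact: (QC 0).
apply: (QD) => //; rewrite -mul_mpolyC; apply: (QM) => //.
rewrite mpolyXE_id; elim/big_ind: _ => [|*|i _]; [exact: (QC 1)|exact: QM|].
by elim: (m i) => [|k IHk]; [exact: (QC 1)|rewrite exprS; exact: QM].
Qed.

(** The nodes lie in the half interval [0, 1/2], so that a cube of half-side at
    most [a / 2] around a node of the grid scaled by [a] stays in the cube of
    half-side [a]. *)
Definition lagrange_node (R : realType) (m k : nat) : R := k%:R / (2 * m.+1%:R).

Lemma lagrange_nodeP (R : realType) (m : nat) (k : 'I_m.+1) :
  0 <= lagrange_node R m k <= 2^-1.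
Proof.
rewrite /lagrange_node divr_ge0 ?mulr_ge0//= ler_pdivrMr ?mulr_gt0//.
by rewrite mulKf// ler_nat ltnW.
Qed.

Lemma lagrange_interpolation (R : realType) (m : nat) :
  exists ell : 'I_m.+1 -> {poly R}, forall p : {poly R}, (size p <= m.+1)%N ->
    p = \sum_(k < m.+1) p.[lagrange_node R m k]%:P * ell k.
Proof.
exists (tnth (m.+1.-lagrange (lagrange_node R m))) => p sp.
apply: lagrange_gen => //.
have n0 : (2 * m.+1%:R)^-1 != 0 :> R by rewrite invr_eq0 mulf_neq0.
by move=> j k /(mulIf n0)/eqP; rewrite eqr_nat => /eqP.
Qed.

(** A bound of the degree in each variable separately: this is the class of
    polynomials that interpolation on a tensor grid reproduces. *)
Definition exponents_le (R : realType) (n m : nat) (p : mpoly n R) :=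
  forall a, a \in msupp p -> forall i, (a i <= m)%N.

(** The monomials of a derivative are those of [p] with one exponent lowered. *)
Lemma exponents_le_mderiv (R : realType) (n m : nat) (p : mpoly n R) (i : 'I_n) :
  (msize p <= m.+1)%N -> exponents_le m (mderiv i p).
Proof.
move=> pm a; rewrite mcoeff_msupp mcoeff_deriv => an0 j.
have : mnm_add a (mnm1 i) \in msupp p.
  by rewrite mcoeff_msupp; apply: contra_neq an0 => ->; rewrite mul0rn.
move=> /msize_mdeg_lt/leq_trans/(_ pm); rewrite ltnS mdegD; apply: leq_trans.
by rewrite mdegE (bigD1 j)//= -!addnA leq_addr.
Qed.

Definition grid_node (R : realType) (n m : nat) (f : {ffun 'I_n -> 'I_m.+1}) :
  'rV[R]_n := \row_i lagrange_node R m (f i).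

Definition grid_basis (R : realType) (n m : nat) (ell : 'I_m.+1 -> {poly R})
  (f : {ffun 'I_n -> 'I_m.+1}) (z : 'rV[R]_n) : R := \prod_i (ell (f i)).[z 0 i].

(** For a monomial the formula is the product over the variables of the
    interpolation formula in one variable, expanded by distributivity. The grid is
    placed at [c] and scaled by [a]; a power of a coordinate is still a polynomial
    of the same degree in the rescaled coordinate. *)
Lemma grid_interpolation (R : realType) (n m : nat) (ell : 'I_m.+1 -> {poly R}) :
  (forall p : {poly R}, (size p <= m.+1)%N ->
    p = \sum_(k < m.+1) p.[lagrange_node R m k]%:P * ell k) ->
  forall (p : mpoly n R) (c : 'rV[R]_n) (a : R) (z : 'rV[R]_n), exponents_le m p ->
    meval (fun i => (c + a *: z) 0 i) p =
    \sum_f meval (fun i => (c + a *: grid_node R f) 0 i) p * grid_basis ell f z.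
Proof.
move=> ellP p c a z pm; rewrite mevalE.
under [RHS]eq_bigr do rewrite mevalE mulr_suml.
rewrite exchange_big /=; apply: eq_big_seq => b bp.
under [RHS]eq_bigr do rewrite -mulrA.
rewrite -mulr_sumr; congr (_ * _).
transitivity (\prod_i \sum_(k < m.+1)
    (c 0 i + a * lagrange_node R m k) ^+ b i * (ell k).[z 0 i]).
  apply: eq_bigr => i _; pose q : {poly R} := ((c 0 i)%:P + a *: 'X) ^+ b i.
  have qE t : q.[t] = (c 0 i + a * t) ^+ b i by rewrite /q !hornerE.
  have sq : (size q <= m.+1)%N.
    apply: leq_trans (size_poly_exp_leq _ _) _; rewrite ltnS.
    apply: leq_trans (pm b bp i); rewrite -[leqRHS]mul1n leq_mul2r; apply/orP; right.
    rewrite -subn1 leq_subLR; apply: leq_trans (size_polyD _ _) _.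
    rewrite geq_max size_polyC (leq_trans (size_scale_leq _ _)) ?size_polyX//.
    by case: (_ != 0).
  rewrite !mxE -qE (ellP q sq) horner_sum; apply: eq_bigr => k _.
  by rewrite hornerM hornerC qE.
rewrite bigA_distr_bigA; apply: eq_bigr => f _.
by rewrite /grid_basis -big_split /=; apply: eq_bigr => i _; rewrite !mxE.
Qed.

Lemma poly_bounded (R : realType) (p : {poly R}) (M : R) :
  exists2 B, 0 <= B & forall z, `|z| <= M -> `|p.[z]| <= B.
Proof.
exists (\sum_(i < size p) `|p`_i| * `|M| ^+ i).
  by apply: sumr_ge0 => i _; rewrite mulr_ge0// exprn_ge0.
move=> z zM; rewrite horner_coef; apply: le_trans (ler_norm_sum _ _ _) _.
apply: ler_sum => i _; rewrite normrM ler_wpM2l// normrX lerXn2r ?nnegrE//.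
by apply: le_trans zM _; exact: ler_norm.
Qed.

Lemma continuous_grid_basis (R : realType) (n m : nat)
    (ell : 'I_m.+1 -> {poly R}) (f : {ffun 'I_n -> 'I_m.+1}) :
  continuous (grid_basis ell f).
Proof.
rewrite /grid_basis => z; elim: (index_enum _) => [|i s IH].
  by under eq_fun do rewrite big_nil; exact: cst_continuous.
under eq_fun do rewrite big_cons.
have ci : {for z, continuous (fun y : 'rV[R]_n => (ell (f i)).[y 0 i] : R)}.
  apply: (@continuous_comp _ _ _ (fun y : 'rV[R]_n => y 0 i) (horner (ell (f i)))).
    exact: coord_continuous.
  exact: continuous_horner.
exact: (continuousM ci IH).
Qed.

(** [x0] is the node of the scaled grid at which the polynomial is largest. By
    interpolation, the polynomial divided by its value at [x0] is a combination of
    the fixed functions [grid_basis] with coefficients at most 1. Hence it is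
    bounded on the cube of half-side [M a], and its modulus of continuity at the
    nodes is that of these finitely many functions. *)
Lemma polynomial_norm_equivalence (R : realType) (n m : nat) (M : R) :
  0 <= M -> exists C eta : R, [/\ 0 < C, 0 < eta, eta <= 2^-1 &
    forall (p : mpoly n R) (c : 'rV[R]_n) (a : R), exponents_le m p -> 0 < a ->
    let P (y : 'rV[R]_n) := meval (fun i => y 0 i) p in
    exists x0, [/\ `|x0 - c| <= a / 2,
      forall y, `|y - c| <= M * a -> `|P y| <= C * `|P x0| &
      forall y, `|y - x0| <= eta * a -> `|P x0| / 2 <= `|P y|]].
Proof.
move=> M0; have [ell ellP] := lagrange_interpolation R m.
pose F := grid_basis (n := n) ell; pose nd := grid_node R (n := n) (m := m).
pose N : R := 1 + #|{ffun 'I_n -> 'I_m.+1}|%:R.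
have N0 : 0 < N by rewrite ltr_pwDl.
have /choice[Bk Bk0] : forall k, exists B,
    0 <= B /\ forall z, `|z| <= M -> `|(ell k).[z]| <= B.
  by move=> k; have [B ? ?] := poly_bounded (ell k) M; exists B.
pose B := 1 + \sum_k Bk k.
have sB0 : 0 <= \sum_k Bk k by apply: sumr_ge0 => k _; have [] := Bk0 k.
have B0 : 0 < B by rewrite ltr_pwDl.
have FB f (z : 'rV[R]_n) : `|z| <= M -> `|F f z| <= B ^+ n.
  move=> /(normr_le_coord _ M0) zM; rewrite normr_prod.
  rewrite -[n in leRHS]card_ord -prodr_const; apply: ler_prod => i _.
  rewrite normr_ge0 /=; have [_ /(_ _ (zM i))] := Bk0 (f i).
  move/le_trans; apply; rewrite /B (bigD1 (f i))//= addrCA lerDl addr_ge0//.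
  by apply: sumr_ge0 => k _; have [] := Bk0 k.
(* N exceeds the number of nodes, so that N errors of size 1 / (2 N) stay below
   one half *)
have [eta [eta0 eta1 Feta]] : exists eta : R, [/\ 0 < eta, eta <= 2^-1 &
    forall f g (z : 'rV[R]_n), `|z - nd g| <= eta -> `|F f z - F f (nd g)| <= (2 * N)^-1].
  have H : \forall eta \near (0 : R)^'+, forall fg, forall z : 'rV[R]_n,
      `|z - nd fg.2| <= eta -> `|F fg.1 z - F fg.1 (nd fg.2)| <= (2 * N)^-1.
    apply: filter_forall => -[f g] /=.
    have cF : F f z @[z --> nd g] --> F f (nd g) by exact: continuous_grid_basis.
    have N20 : 0 < (2 * N)^-1 by rewrite invr_gt0 mulr_gt0.
    have /cvgrPdist_le/(_ _ N20)/nbhs_ballP[e /= e0 He] := cF.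
    near=> eta => z zeta; rewrite distrC; apply: He; rewrite -ball_normE /= distrC.
    apply: le_lt_trans zeta _; near: eta; exact: nbhs_right_lt.
  near (0 : R)^'+ => eta; exists eta; split.
  - by near: eta; exact: nbhs_right_gt.
  - by near: eta; apply: nbhs_right_le.
  - have K : forall fg, forall z : 'rV[R]_n, `|z - nd fg.2| <= eta ->
      `|F fg.1 z - F fg.1 (nd fg.2)| <= (2 * N)^-1 by near: eta; exact: H.
    by move=> f g z; exact: (K (f, g) z).
exists (N * B ^+ n), eta; split=> //; first by rewrite mulr_gt0// exprn_gt0.
move=> p c a pm a0 P.
pose val f := `|P (c + a *: nd f)|.
have [fmax _ maxP] := @arg_maxP _ _ _ [ffun=> ord0] xpredT val isT.
have interp z : P (c + a *: z) = \sum_f P (c + a *: nd f) * F f z.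
  exact: grid_interpolation.
have rescale y : y = c + a *: (a^-1 *: (y - c)).
  by rewrite scalerA divff ?gt_eqF// scale1r addrC subrK.
have Py y : P y = \sum_f P (c + a *: nd f) * F f (a^-1 *: (y - c)).
  by rewrite {1}(rescale y) interp.
have scale_le (y y' : 'rV[R]_n) s : `|y - y'| <= s * a -> `|a^-1 *: (y - y')| <= s.
  by move=> h; rewrite normrZ gtr0_norm ?invr_gt0// ler_pdivrMl// mulrC.
exists (c + a *: nd fmax); split.
- rewrite addrC addKr normrZ gtr0_norm//; apply: ler_wpM2l; first exact: ltW.
  apply/normr_le_coord => // i; rewrite mxE.
  by have /andP[n0 n1] := lagrange_nodeP R (fmax i); rewrite ger0_norm.
- move=> y yc; rewrite [P y]Py -/(val fmax); apply: le_trans (ler_norm_sum _ _ _) _.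
  apply: (@le_trans _ _ (\sum_(f : {ffun 'I_n -> 'I_m.+1}) val fmax * B ^+ n)).
    apply: ler_sum => f _; rewrite normrM ler_pM//; first exact: maxP.
    by apply: FB; exact: scale_le.
  rewrite sumr_const -mulr_natl mulrA mulrAC; apply: ler_wpM2r; first exact: normr_ge0.
  by apply: ler_wpM2r; [exact/exprn_ge0/ltW|rewrite lerDr].
- move=> y yx0; set z := a^-1 *: (y - c).
  have zn : `|z - nd fmax| <= eta.
    have -> : z - nd fmax = a^-1 *: (y - (c + a *: nd fmax)).
      by rewrite opprD addrA scalerBr scalerA mulVf ?gt_eqF// scale1r.
    exact: scale_le.
  have D : `|P y - P (c + a *: nd fmax)| <= val fmax / 2.
    rewrite [P y]Py -/z [P (_ + _)]interp -sumrB; apply: le_trans (ler_norm_sum _ _ _) _.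
    apply: (@le_trans _ _ (\sum_(f : {ffun 'I_n -> 'I_m.+1}) val fmax * (2 * N)^-1)).
      apply: ler_sum => f _; rewrite -mulrBr normrM ler_pM//; first exact: maxP.
      exact: Feta.
    rewrite sumr_const -mulrnAr; apply: ler_wpM2l; first exact: normr_ge0.
    by rewrite -mulr_natr invfM -mulrA ler_piMr// mulrC ler_pdivrMr// mul1r lerDr.
  rewrite -/(val fmax); have := ler_distD 0 (P (c + a *: nd fmax)) (P y).
  have := lerB_dist (P (c + a *: nd fmax)) (P y).
  rewrite distrC -/(val fmax); move: D; lra.
Unshelve. all: by end_near. Qed.

(** The hypothesis on [T] is the form in which an L^2 bound of the gradient on the
    cube around [c] is used: a derivative that exceeds [t] on a whole subcube of
    half-side [eta * a] forces [t <= T]. *)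
Lemma polynomial_oscillation (R : realType) (n m : nat) (M : R) :
  0 <= M -> exists C eta : R, [/\ 0 <= C, 0 < eta, eta <= 2^-1 &
    forall (p : mpoly n R) (c : 'rV[R]_n) (a T : R),
    (msize p <= m.+1)%N -> 0 < a -> 0 <= T ->
    let P (y : 'rV[R]_n) := meval (fun i => y 0 i) p in
    let DP i (y : 'rV[R]_n) := meval (fun i => y 0 i) (mderiv i p) in
    (forall i x0 t, `|x0 - c| <= a / 2 -> 0 <= t ->
       (forall y, `|y - x0| <= eta * a -> t <= `|DP i y|) -> t <= T) ->
    forall x y, `|x - c| <= M * a -> `|y - c| <= M * a ->
    `|P y - P x| <= C * T * `|y - x|].
Proof.
move=> M0; have [C [eta [C0 eta0 eta1 H]]] := @polynomial_norm_equivalence R n m M M0.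
exists (n%:R * (C * 2)), eta; split=> //; first by rewrite !mulr_ge0// ltW.
move=> p c a T pm a0 T0 P DP HT x y xc yc.
have DPle i z : `|z - c| <= M * a -> `|DP i z| <= C * 2 * T.
  have [x0 [x0c up low]] := H (mderiv i p) c a (exponents_le_mderiv pm) a0.
  move=> /up /le_trans; apply; rewrite -mulrA; apply: ler_wpM2l; first exact: ltW.
  rewrite mulrC -ler_pdivrMr//; exact: (HT i x0).
have dP z v : is_derive z v P (\sum_i v 0 i * DP i z) by exact: is_derive_meval.
have := @line_mean_value R _ P x (y - x) 0 1 (n%:R * (C * 2) * T * `|y - x|).
rewrite scale1r subrK scale0r add0r subr0 normr1 mulr1; apply.
rewrite (min_idPl _) ?ler01// (max_idPr _) ?ler01// => s /andP[s0 s1].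
have [Dz ->] := dP (s *: (y - x) + x) (y - x); split=> //.
have zc : `|s *: (y - x) + x - c| <= M * a.
  have -> : s *: (y - x) + x - c = s *: (y - c) + (1 - s) *: (x - c).
    by apply/rowP => i; rewrite !mxE; ring.
  apply: le_trans (ler_normD _ _) _; rewrite !normrZ (ger0_norm s0) ger0_norm ?subr_ge0//.
  have h1 : s * `|y - c| <= s * (M * a) by apply: ler_wpM2l.
  have h2 : (1 - s) * `|x - c| <= (1 - s) * (M * a) by apply: ler_wpM2l; rewrite ?subr_ge0.
  by apply: le_trans (lerD h1 h2) _; rewrite -mulrDl addrC subrK mul1r.
apply: le_trans (ler_norm_sum _ _ _) _.
have -> : n%:R * (C * 2) * T * `|y - x| = \sum_(i < n) `|y - x| * (C * 2 * T).
  by rewrite sumr_const card_ord -[RHS]mulr_natl; ring.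
apply: ler_sum => i _; rewrite normrM; apply: ler_pM => //; last exact: DPle.
by have /(normr_le_coord _ (normr_ge0 _)) := lexx `|y - x|.
Qed.

(** * Simplices and quasi-uniform meshes *)

Section simplex.
Context (R : realType) (d : nat) (V : 'M[R]_(d.+1, d)).

(** Expresses distances between points of the simplex by its edge vectors. *)
Lemma simplex_combination (l m : 'rV[R]_d.+1) :
  \sum_k l 0 k = 1 -> \sum_k m 0 k = 1 ->
  l *m V - m *m V = \sum_k \sum_j (l 0 k * m 0 j) *: (row k V - row j V).
Proof.
move=> l1 m1; rewrite !mulmx_sum_row.
transitivity (\sum_k \sum_j ((l 0 k * m 0 j) *: row k V)
   - \sum_k \sum_j (l 0 k * m 0 j) *: row j V).
  congr (_ - _).
    by apply: eq_bigr => k _; rewrite -scaler_suml -mulr_sumr m1 mulr1.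
  rewrite exchange_big; apply: eq_bigr => j _.
  by rewrite -scaler_suml -mulr_suml l1 mul1r.
rewrite -sumrB; apply: eq_bigr => k _; rewrite -sumrB.
by apply: eq_bigr => j _; rewrite scalerBr.
Qed.

Let mid : 'rV[R]_d.+1 := const_mx d.+1%:R^-1.

Let mid_gt0 k : 0 < mid 0 k. Proof. by rewrite mxE invr_gt0. Qed.

Let mid1 : \sum_k mid 0 k = 1.
Proof.
under eq_bigr do rewrite mxE.
by rewrite sumr_const card_ord -[LHS]mulr_natl mulfV.
Qed.

Lemma barycenterE : barycenter V = mid *m V.
Proof.
rewrite mulmx_sum_row /barycenter scaler_sumr.
by apply: eq_bigr => k _; rewrite mxE.
Qed.

Lemma barycenter_in : open_simplex V (barycenter V).
Proof. by rewrite barycenterE; exists mid. Qed.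

Lemma ediam_simplex : ediam (open_simplex V) = (diameter V)%:E.
Proof.
rewrite fineK// ge0_fin_numE; last first.
  apply: le_trans (enorm_dist_le_ediam barycenter_in barycenter_in).
  by rewrite lee_fin enorm_ge0.
apply: (@le_lt_trans _ _ (\sum_k \sum_j enorm (row k V - row j V))%:E); last exact: ltry.
apply: ge_ereal_sup => _ [[x y] /= [[l [l0 l1] <-] [m [m0 m1] <-]] <-].
rewrite lee_fin simplex_combination//; apply: le_trans (enorm_sum_le _) _.
apply: ler_sum => k _; apply: le_trans (enorm_sum_le _) _.
apply: ler_sum => j _; rewrite enormZ ler_piMl ?enorm_ge0//.
have le1 (q : 'rV[R]_d.+1) i : (forall i, 0 < q 0 i) -> \sum_k q 0 k = 1 -> q 0 i <= 1.
  move=> q0 <-; rewrite (bigD1 i)//= lerDl.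
  by apply: sumr_ge0 => ? _; exact: ltW.
by rewrite ger0_norm ?mulr_ge0 ?mulr_ile1 ?le1// ltW.
Qed.

Lemma enorm_le_diameter x y :
  open_simplex V x -> open_simplex V y -> enorm (x - y) <= diameter V.
Proof.
move=> Vx Vy; rewrite -lee_fin -ediam_simplex; exact: enorm_dist_le_ediam.
Qed.

(** The diameter is that of the open simplex, which does not contain the vertices:
    they are limits of points moving towards them from the barycenter. *)
Lemma vertex_dist_le k j : enorm (row k V - row j V) <= diameter V.
Proof.
(* the point at fraction e of the way from vertex k to the barycenter *)
pose near k e : 'rV[R]_d.+1 := (1 - e) *: delta_mx 0 k + e *: mid.
have nearV k' e : 0 < e < 1 -> open_simplex V (near k' e *m V).
  move=> /andP[e0 e1]; exists (near k' e) => //; split=> [i|].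
    rewrite !mxE; apply: ltr_wpDl; last by rewrite mulr_gt0// invr_gt0.
    by rewrite mulr_ge0// subr_ge0 ltW.
  under eq_bigr do rewrite mxE [(_ *: delta_mx _ _) _ _]mxE [(_ *: mid) _ _]mxE.
  rewrite big_split -!mulr_sumr /= mid1 mulr1 (bigD1 k')//= big1 => [|i /negPf ik].
    by rewrite mxE !eqxx addr0 mulr1 subrK.
  by rewrite mxE ik andbF.
have dist e : 0 < e < 1 -> (1 - e) * enorm (row k V - row j V) <= diameter V.
  move=> e01; have /andP[e0 e1] := e01.
  apply: le_trans (enorm_le_diameter (nearV k e e01) (nearV j e e01)).
  rewrite -mulmxBl opprD addrACA subrr addr0 -scalerBr -scalemxAl mulmxBl -!rowE.
  by rewrite enormZ ger0_norm// subr_ge0 ltW.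
apply/ler_addgt0Pr => e e0.
pose E := enorm (row k V - row j V).
have E0 : 0 <= E by exact: enorm_ge0.
(* t * E <= e and t < 1 *)
pose t := e / (E + e + 1).
have s0 : 0 < E + e + 1 by rewrite addr_gt0// ltr_wpDl.
have t01 : 0 < t < 1.
  by rewrite divr_gt0//= ltr_pdivrMr// mul1r; lra.
have := dist t t01; rewrite -/E mulrBl mul1r lerBlDr => /le_trans; apply.
rewrite lerD2l mulrAC ler_pdivrMr//; nra.
Qed.

(** The barycenter puts weight [1 / (d + 1)] on each vertex, and a vertex of the
    combination is at distance 0 from itself and at most the diameter from the [d]
    other ones. *)
Lemma barycenter_dist_le x : open_simplex V x ->
  enorm (x - barycenter V) <= d%:R / d.+1%:R * diameter V.
Proof.
move=> [l [l0 l1] <-]; rewrite barycenterE simplex_combination//.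
apply: le_trans (enorm_sum_le _) _.
have D0 : 0 <= diameter V.
  by apply: le_trans (vertex_dist_le ord0 ord0); exact: enorm_ge0.
apply: (@le_trans _ _ (\sum_k l 0 k * (d%:R / d.+1%:R * diameter V))); last first.
  by rewrite -mulr_suml l1 mul1r.
apply: ler_sum => k _; apply: le_trans (enorm_sum_le _) _.
rewrite (bigD1 k)//= subrr scaler0 enorm0 add0r.
apply: (@le_trans _ _ (\sum_(j | j != k) l 0 k / d.+1%:R * diameter V)).
  apply: ler_sum => j _; rewrite enormZ mxE ger0_norm; last first.
    by rewrite mulr_ge0 ?invr_ge0// ltW.
  by apply: ler_wpM2l; [rewrite divr_ge0// ltW|exact: vertex_dist_le].
rewrite sumr_const cardC1 card_ord /= -[leLHS]mulr_natl.
by rewrite le_eqVlt; apply/orP; left; apply/eqP; ring.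
Qed.

(** In a simplex of diameter 0 all the vertices coincide. *)
Lemma diameter_gt0 : (0 < d)%N -> affinely_independent V -> 0 < diameter V.
Proof.
move=> d0 Vfree; rewrite lt_neqAle.
have D0 : 0 <= diameter V.
  by apply: le_trans (vertex_dist_le ord0 ord0); exact: enorm_ge0.
rewrite D0 andbT; apply/negP => /eqP D.
have rows k : row k V = row ord0 V.
  apply/rowP => i; apply/eqP; rewrite -subr_eq0 -normr_le0.
  have := coord_le_enorm (row k V - row ord0 V) i; rewrite !mxE => /le_trans; apply.
  by rewrite D; exact: vertex_dist_le.
pose u : 'rV[R]_d.+1 := delta_mx 0 ord_max - delta_mx 0 ord0.
have : u == 0.
  rewrite -(mulmx_free_eq0 _ Vfree) mulmxBl -!rowE !row_row_mx rows subr_eq0.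
  by apply/eqP; congr row_mx; apply/rowP => i; rewrite !mxE.
move=> /eqP/rowP/(_ ord0)/eqP; rewrite !mxE !eqxx/= -val_eqE /=.
by rewrite (ltn_eqF d0) sub0r oppr_eq0 oner_eq0.
Qed.

End simplex.

Lemma inradius_ge0 (R : realType) (d : nat) (V : 'M[R]_(d.+1, d)) : 0 <= inradius V.
Proof.
rewrite /inradius; set E := [set r | _].
have [sE|/sup_out ->//] := pselect (has_sup E).
have [r rE] := sE.1; apply: (@le_trans _ _ r); first by case: rE => /ltW.
exact: (ub_le_sup sE.2).
Qed.

Lemma diameter_le_mesh_size (R : realType) (d N : nat)
    (K : 'I_N -> 'M[R]_(d.+1, d)) (i : 'I_N) : diameter (K i) <= mesh_size K.
Proof.
apply: ub_le_sup; last by exists i.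
exists (\sum_j `|diameter (K j)|) => _ [j _ <-].
rewrite (bigD1 j)//=; apply: le_trans (ler_norm _) _.
by rewrite lerDl sumr_ge0.
Qed.

(** [C] is only known to be real; [1 + |C|] is a positive constant that works as
    well since inradii are nonnegative. *)
Lemma quasi_uniform_inscribed_ball (R : realType) (d N : nat)
    (K : 'I_N -> 'M[R]_(d.+1, d)) (C : R) (i : 'I_N) :
  0 < diameter (K i) -> mesh_size K <= C * mesh_inradius K ->
  exists r c, diameter (K i) / (2 * (1 + `|C|)) < r /\
    eball c r `<=` open_simplex (K i).
Proof.
move=> h0 hC; pose h := diameter (K i); pose rho := inradius (K i).
have hs : h <= mesh_size K by exact: diameter_le_mesh_size.
have lb0 : lbound (range (fun j => inradius (K j))) 0.
  by move=> _ [j _ <-]; exact: inradius_ge0.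
have ir : mesh_inradius K <= rho by apply: ge_inf; [exists 0|exists i].
have mr0 : 0 <= mesh_inradius K.
  by apply: lb_le_inf => //; exists rho, i.
have C1 : 0 < 1 + `|C| by rewrite ltr_pwDl.
have h1 : h <= (1 + `|C|) * rho.
  apply: le_trans hs (le_trans hC _).
  apply: (@le_trans _ _ ((1 + `|C|) * mesh_inradius K)); last first.
    by apply: ler_wpM2l => //; exact: ltW.
  by apply: ler_wpM2r => //; apply: le_trans (ler_norm C) _; rewrite lerDr.
pose q := h / (2 * (1 + `|C|)).
have q0 : 0 < q by rewrite divr_gt0// mulr_gt0.
have q_rho : q < rho.
  rewrite ltr_pdivrMr ?mulr_gt0//.
  have rho0 : 0 < (1 + `|C|) * rho by exact: lt_le_trans h1.
  by apply: le_lt_trans h1 _; lra.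
move: q_rho; rewrite /rho /inradius; set E := [set r | _] => qE.
have [E0|/set0P nE] := eqVneq E set0.
  by move: qE; rewrite E0 sup0 ltNge (ltW q0).
have [r [r0 [c cV]] qr] := sup_gt nE qE.
by exists r, c.
Qed.

(** * The estimate on a cut element *)

(** [w] agrees with the polynomial on an open ball, so also its derivatives do. *)
Lemma grad_poly_on (R : realType) (n : nat) (w : 'rV[R]_n.+1 -> R)
    (p : mpoly n.+1 R) (c y : 'rV[R]_n.+1) (r : R) (i : 'I_n.+1) :
  (forall x, eball c r x -> w x = meval (fun i => x 0 i) p) -> eball c r y ->
  grad w y 0 i = meval (fun i => y 0 i) (mderiv i p).
Proof.
move=> wp yB; rewrite mxE.
have -> : 'D_(delta_mx 0 i) w y = 'D_(delta_mx 0 i)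
    (fun x : 'rV[R]_n.+1 => meval (fun i => x 0 i) p) y.
  by apply: near_eq_derive; apply: filterS (eball_open yB) => z; exact: wp.
have [_ ->] := is_derive_meval p y (delta_mx 0 i).
rewrite (bigD1 i)//= big1 => [|j /negPf ji]; first by rewrite mxE !eqxx mul1r addr0.
by rewrite mxE ji andbF mul0r.
Qed.

(** A component is at most the norm of the gradient, and the cube on which it is at
    least [t] has volume [(2 e) ^ (n + 1)]. *)
Lemma gradient_norm_ge (R : realType) (n : nat) (A : set 'rV[R]_n.+1)
    (w : 'rV[R]_n.+1 -> R) (i : 'I_n.+1) (x0 : 'rV[R]_n.+1) (e t : R) :
  0 <= e -> 0 <= t ->
  (forall y, `|y - x0| <= e -> A y /\ t <= `|grad w y 0 i|) ->
  ((t * Num.sqrt ((e * 2) ^+ n.+1))%:E <=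
   Lnorm_on lebesgue_rV 2%:E A (fun x => enorm (grad w x)))%E.
Proof.
move=> e0 t0 H; pose u := x0 - const_mx e; pose v := x0 + const_mx e.
have boxE y : box u v y -> `|y - x0| <= e.
  move=> yB; apply/normr_le_coord => // j.
  by have := yB j; rewrite !mxE ler_distl.
have uv j : v 0 j - u 0 j = e * 2 by rewrite !mxE; ring.
apply: (@Lnorm_on_2_ge _ _ _ _ (box u v)) => //.
- by rewrite exprn_ge0// mulr_ge0.
- exact: caratheodory_box.
- by move=> y /boxE/H[].
- move=> y /boxE/H[_ /le_trans]; apply.
  by rewrite [leRHS]ger0_norm ?enorm_ge0//; exact: coord_le_enorm.
- have := @lebesgue_rV_box_ge R n.+1 u v.
  under eq_bigr do rewrite uv.
  rewrite prodr_const card_ord; apply => j.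
  by rewrite -subr_ge0 uv mulr_ge0.
Qed.

Lemma surface_norm_ge (R : realType) (n : nat) (Gamma B : set 'rV[R]_n.+1)
    (w : 'rV[R]_n.+1 -> R) (x : 'rV[R]_n.+1) (r t v : R) :
  closed Gamma -> 0 < r -> 0 <= t -> 0 <= v ->
  (v%:E <= hausdorff n (Gamma `&` [set y | (`|y - x| <= r)%R]))%E ->
  (forall y, `|y - x| <= r -> B y /\ t <= `|w y|) ->
  ((t * Num.sqrt v)%:E <= Lnorm_on (hausdorff n) 2%:E (Gamma `&` B) w)%E.
Proof.
move=> cG r0 t0 v0 vle H.
apply: (@Lnorm_on_2_ge _ _ _ _ (Gamma `&` [set y | `|y - x| <= r])) => //.
- apply: closed_caratheodory; apply: closedI => //.
  have -> : [set y : 'rV[R]_n.+1 | `|y - x| <= r] = closed_ball x r.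
    by rewrite closed_ballE//; apply/seteqP; split=> y; rewrite /closed_ball_ /= distrC.
  exact: closed_ball_closed.
- by move=> y [Gy /H[]].
- by move=> y [_ /H[]].
Qed.

(** Brings the power of [h] of the estimate, in dimension [n + 1], to the form in
    which the area of the surface produces it. *)
Lemma powR_scaling_exponent (R : realType) (h : R) (n : nat) : 0 < h ->
  h `^ ((1 - n.+1%:R) / 2) = (Num.sqrt (h ^+ n))^-1.
Proof.
move=> h0; have -> : (1 - n.+1%:R) / 2 = - (n%:R * 2^-1) :> R.
  by rewrite -natr1; ring.
by rewrite powRN powRrM powR_mulrn ?ltW// powR12_sqrt// exprn_ge0// ltW.
Qed.

(** With [d = n + 1], the scales are [a = h / (2 * Cn * d)], the half-side of a
    cube that fits in the inscribed ball, and [r = kap * h], small enough for the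
    ball of radius [r] around a point of the element to stay in [B]; this uses that
    a point of the simplex is at distance at most [d / (d + 1) * h] from the
    barycenter. The constants [cs] and [cg] are what is left of the square roots of
    the area [eps * r ^ n] and of the volume of the small cube once the powers of
    [h] are taken out. *)
Lemma element_estimate (R : realType) (n m : nat) (Cn eps : R) :
  0 < Cn -> 0 < eps -> exists2 C, 0 < C &
    forall (Gamma : set 'rV[R]_n.+1) (V : 'M[R]_(n.+2, n.+1)) (c : 'rV[R]_n.+1)
      (rho : R) (w : 'rV[R]_n.+1 -> R),
    closed Gamma ->
    (forall x r, Gamma x -> 0 < r -> r <= eps ->
      ((eps * r ^+ n)%:E <= hausdorff n (Gamma `&` [set y | (`|y - x| <= r)%R]))%E) ->
    let h := diameter V in
    0 < h -> h < eps -> h / (2 * Cn) < rho -> eball c rho `<=` open_simplex V ->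
    let B := eball (barycenter V) h in
    poly_on m B w ->
    (Lnorm_on (hausdorff n) +oo (open_simplex V `&` Gamma) w
     <= (C * h `^ ((1 - n.+1%:R) / 2))%:E *
        (Lnorm_on (hausdorff n) 2%:E (Gamma `&` B) w
         + (h `^ (2^-1))%:E *
           Lnorm_on lebesgue_rV 2%:E (open_simplex V)
             (fun x => enorm (grad w x))))%E.
Proof.
move=> Cn0 eps0; pose k1 := 2 * Cn * n.+1%:R.
have k10 : 0 < k1 by rewrite !mulr_gt0.
have M0 : 0 <= 2 * k1 by rewrite mulr_ge0// ltW.
have [C1 [eta [C10 eta0 eta1 osc]]] := @polynomial_oscillation R n.+1 m (2 * k1) M0.
pose kap : R := (2 * n.+1%:R * n.+2%:R)^-1.
have kap0 : 0 < kap by rewrite invr_gt0 !mulr_gt0.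
pose cg := Num.sqrt ((eta / k1 * 2) ^+ n.+1).
have cg0 : 0 < cg by rewrite sqrtr_gt0 exprn_gt0// mulr_gt0// divr_gt0.
pose cs := Num.sqrt (eps * kap ^+ n).
have cs0 : 0 < cs by rewrite sqrtr_gt0 mulr_gt0// exprn_gt0.
exists (cs^-1 + C1 * kap / cg).
  by rewrite ltr_pwDl ?invr_gt0// divr_ge0 ?mulr_ge0// ltW.
move=> Gamma V c rho w cG surf h h0 heps hrho cV B [p pm wp].
set s := Lnorm_on _ 2%:E (Gamma `&` B) w.
set g := Lnorm_on lebesgue_rV _ _ _.
have s_ge0 : (0 <= s)%E by exact: Lnorm_ge0.
have g_ge0 : (0 <= g)%E by exact: Lnorm_ge0.
set C := cs^-1 + _.
have Cgt0 : 0 < C by rewrite ltr_pwDl ?invr_gt0// divr_ge0 ?mulr_ge0// ltW.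
rewrite powR_scaling_exponent// powR12_sqrt; last exact: ltW.
have hn0 : 0 < Num.sqrt (h ^+ n) by rewrite sqrtr_gt0 exprn_gt0.
have sh0 : 0 < Num.sqrt h by rewrite sqrtr_gt0.
have Chp0 : 0 < C / Num.sqrt (h ^+ n) by rewrite divr_gt0.
(* an infinite norm makes the right-hand side infinite *)
have [sfin|] := boolP (s \is a fin_num); last first.
  rewrite ge0_fin_numE// ltey negbK => /eqP ->.
  rewrite addye; last by rewrite gt_eqF// (lt_le_trans ltNy0)// mule_ge0// lee_fin ltW.
  by rewrite gt0_muley ?lte_fin// leey.
have [gfin|] := boolP (g \is a fin_num); last first.
  rewrite ge0_fin_numE// ltey negbK => /eqP ->.
  rewrite [X in (_ + X)%E]gt0_muley ?lte_fin// addey; last first.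
    by rewrite gt_eqF// (lt_le_trans ltNy0).
  by rewrite gt0_muley ?lte_fin// leey.
rewrite -(fineK sfin) -(fineK gfin).
set sr := fine s; set gr := fine g.
have sr0 : 0 <= sr by exact: fine_ge0.
have gr0 : 0 <= gr by exact: fine_ge0.
set hn := Num.sqrt (h ^+ n) in hn0 Chp0 *; set sh := Num.sqrt h in sh0 *.
apply: (@le_trans _ _ (C / hn * (sr + sh * gr))%:E); last first.
  by rewrite EFinM EFinD EFinM.
apply: Lnorm_on_pinfty_le.
  by rewrite lee_fin; apply: mulr_ge0; [exact: ltW|rewrite addr_ge0// mulr_ge0// ltW].
move=> x [Vx Gx]; rewrite lee_fin.
have hE : h = sh * sh by rewrite -expr2 sqr_sqrtr// ltW.
pose b := barycenter V; pose P (y : 'rV[R]_n.+1) := meval (fun i => y 0 i) p.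
pose a := h / k1; pose r := kap * h.
have a0 : 0 < a by rewrite divr_gt0.
have r0 : 0 < r by rewrite mulr_gt0.
have n10 : 0 < n.+1%:R :> R by [].
have n20 : 0 < n.+2%:R :> R by [].
have nS : n.+2%:R = n.+1%:R + 1 :> R by rewrite -natr1.
have n11 : 1 <= n.+1%:R :> R by rewrite ler1n.
have kap1 : kap <= 1.
  by rewrite invf_le1 ?mulr_gt0// nS; nra.
have reps : r <= eps.
  by apply: le_trans (ltW heps); rewrite ler_piMl// ltW.
pose q : R := n.+1%:R / n.+2%:R.
have qh : q * h + h / n.+2%:R = h.
  by rewrite /q mulrAC -mulrDl -{2}[h]mul1r -mulrDl -nS mulrAC mulfV ?mul1r// gt_eqF.
have hn2 : 0 < h / n.+2%:R by rewrite divr_gt0.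
have VqB (y : 'rV[R]_n.+1) : open_simplex V y -> enorm (y - b) <= q * h.
  exact: barycenter_dist_le.
have VB (y : 'rV[R]_n.+1) : open_simplex V y -> B y.
  by move=> /VqB/le_lt_trans; apply; rewrite -[ltRHS]qh ltrDl.
have xB (y : 'rV[R]_n.+1) : `|y - x| <= r -> B y.
  move=> yr; rewrite /B /eball /=.
  have -> : y - barycenter V = (y - x) + (x - b) by rewrite addrA subrK.
  apply: le_lt_trans (enormD _ _) _; rewrite -[ltRHS]qh addrC.
  apply: ler_ltD; first exact: VqB.
  apply: le_lt_trans (enorm_le_normr _) _.
  apply: (@le_lt_trans _ _ (n.+1%:R * r)); first by apply: ler_wpM2l.
  have -> : n.+1%:R * r = h / n.+2%:R / 2.
    by rewrite /r /kap; field; rewrite !gt_eqF.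
  by rewrite ltr_pdivrMr// mulr2n mulrDr mulr1 ltrDl.
have cVc : open_simplex V c.
  apply: cV; rewrite /eball /= subrr enorm0; apply: le_lt_trans hrho.
  by rewrite divr_ge0 ?mulr_ge0// ltW.
have Ba (y : 'rV[R]_n.+1) : B y -> `|y - c| <= 2 * k1 * a.
  move=> yB; apply: le_trans (normr_le_enorm _) _.
  have -> : 2 * k1 * a = h + h by rewrite /a; field; rewrite gt_eqF.
  have -> : y - c = (y - b) + (-1) *: (c - b).
    by rewrite scaleN1r opprB addrA subrK.
  apply: le_trans (enormD _ _) _; rewrite enormZ normrN1 mul1r.
  by apply: lerD; apply: ltW => //; exact: VB.
have aV (y : 'rV[R]_n.+1) : `|y - c| <= a -> open_simplex V y.
  move=> ya; apply: cV; rewrite /eball /=.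
  apply: le_lt_trans (enorm_le_normr _) _; apply: le_lt_trans hrho.
  have -> : h / (2 * Cn) = n.+1%:R * a by rewrite /a /k1; field; rewrite !gt_eqF.
  exact: ler_wpM2l.
pose cube := Num.sqrt ((eta * a * 2) ^+ n.+1).
have cubeE : cube = cg * (hn * sh).
  rewrite /cube /cg /hn /sh -!sqrtrM ?exprn_ge0 ?mulr_ge0 ?invr_ge0
    ?(ltW eta0) ?(ltW k10) ?(ltW h0)//.
  by congr Num.sqrt; rewrite -exprSr -exprMn /a; congr (_ ^+ _); field; rewrite gt_eqF.
have cube0 : 0 < cube by rewrite cubeE !mulr_gt0.
(* a derivative larger than T on a whole small cube has an L^2 norm above gr *)
pose T := gr / cube.
have T0 : 0 <= T by rewrite divr_ge0// ltW.
have DT i x0 t : `|x0 - c| <= a / 2 -> 0 <= t ->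
    (forall y : 'rV[R]_n.+1, `|y - x0| <= eta * a ->
      t <= `|meval (fun j => y 0 j) (mderiv i p)|) -> t <= T.
  move=> x0c t0 tle; rewrite ler_pdivlMr// -lee_fin [leRHS](fineK gfin).
  apply: (@gradient_norm_ge _ _ _ _ i x0) => //; first by rewrite mulr_ge0// ltW.
  move=> y yx0; have Vy : open_simplex V y.
    apply: aV; have -> : y - c = (y - x0) + (x0 - c) by rewrite addrA subrK.
    apply: le_trans (ler_normD _ _) _.
    have -> : a = 2^-1 * a + a / 2 by field.
    apply: lerD => //; apply: le_trans yx0 _; apply: ler_wpM2r => //; exact: ltW.
  by split=> //; rewrite (grad_poly_on i wp (VB _ Vy)); exact: tle.
have Px : w x = P x by apply/wp/VB.
have oscx (y : 'rV[R]_n.+1) : `|y - x| <= r -> `|w x| - C1 * T * r <= `|w y|.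
  move=> yr; have yB := xB y yr; rewrite Px (wp y yB).
  have H := osc p c a T pm a0 T0 DT x y (Ba _ (VB _ Vx)) (Ba _ yB).
  have H2 : `|P y - P x| <= C1 * T * r.
    by apply: le_trans H _; apply: ler_wpM2l => //; rewrite mulr_ge0.
  have := lerB_dist (P x) (P y); rewrite [`|P x - _|]distrC -/(P y).
  by move: H2; lra.
(* t is the part of w x that its oscillation leaves at all the points near x *)
pose t := Num.max 0 (`|w x| - C1 * T * r).
have t0 : 0 <= t by rewrite le_max lexx.
have tx : `|w x| - C1 * T * r <= t by rewrite le_max lexx orbT.
have v0 : 0 <= eps * r ^+ n by rewrite mulr_ge0 ?exprn_ge0// ltW.
have := @surface_norm_ge R n Gamma B w x r t (eps * r ^+ n) cG r0 t0 v0
  (surf x r Gx r0 reps).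
rewrite -/s -(fineK sfin) lee_fin -/sr => tsr.
have {tsr} : t * Num.sqrt (eps * r ^+ n) <= sr.
  apply: tsr => y yr; split; first exact: xB.
  by rewrite ge_max normr_ge0 oscx.
have -> : Num.sqrt (eps * r ^+ n) = cs * hn.
  rewrite /cs /hn -sqrtrM ?mulr_ge0 ?exprn_ge0 ?(ltW eps0) ?(ltW kap0)//.
  by rewrite /r exprMn mulrA.
rewrite -ler_pdivlMr ?mulr_gt0// => tle.
have Tr : C1 * T * r = C1 * kap / cg / hn * (sh * gr).
  rewrite /T cubeE /r hE; field.
  by rewrite !gt_eqF.
apply: (@le_trans _ _ (sr / (cs * hn) + C1 * kap / cg / hn * (sh * gr))).
  by rewrite -Tr -lerBlDr; exact: le_trans tx tle.
have e1 : 0 <= cs^-1 / hn * (sh * gr).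
  by rewrite !mulr_ge0 ?invr_ge0// ltW.
have e2 : 0 <= C1 * kap / cg / hn * sr.
  by rewrite !mulr_ge0 ?invr_ge0// ltW.
have -> : C / hn * (sr + sh * gr) = sr / (cs * hn) + C1 * kap / cg / hn * (sh * gr)
    + (cs^-1 / hn * (sh * gr) + C1 * kap / cg / hn * sr).
  by rewrite /C; field; rewrite !gt_eqF.
by rewrite lerDl addr_ge0.
Qed.

Lemma closed_interface (R : realType) (d : nat) (Omega Gamma : set 'rV[R]_d)
    (Omega_ : 'I_2 -> set 'rV[R]_d) :
  interface Omega Gamma Omega_ -> closed Gamma.
Proof.
move=> [_ _ _ _ _ _ _ ->]; apply: closedI; rewrite /frontier setDE;
  by apply: closedI; [exact: closed_closure|apply: open_closedC; exact: open_interior].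
Qed.

Lemma cut_element_estimate (R : realType) (n : nat)
    (Omega Gamma : set 'rV[R]_n.+1) (Omega_ : 'I_2 -> set 'rV[R]_n.+1)
    (m : nat) (Cnu : R) :
  interface Omega Gamma Omega_ -> C2_smooth Gamma ->
  exists h0 C : R, [/\ 0 < h0, 0 < C &
    forall (N : nat) (K : 'I_N -> 'M[R]_(n.+2, n.+1)),
      mesh Omega K ->
      mesh_size K <= Cnu * mesh_inradius K ->
      mesh_size K < h0 ->
      forall (w : 'rV[R]_n.+1 -> R) (i : 'I_N),
        let hK := diameter (K i) in
        let B := eball (barycenter (K i)) hK in
        poly_on m B w ->
        (Lnorm_on (hausdorff n) +oo (open_simplex (K i) `&` Gamma) w
         <= (C * hK `^ ((1 - n.+1%:R) / 2))%:E *
            (Lnorm_on (hausdorff n) 2%:E (Gamma `&` B) w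
             + (hK `^ (2^-1))%:E *
               Lnorm_on lebesgue_rV 2%:E (open_simplex (K i))
                 (fun x => enorm (grad w x))))%E].
Proof.
move=> hGamma hC2; have cG := closed_interface hGamma.
have compG : compact Gamma.
  by have := interface_compact hGamma; rewrite -(closure_id _).1.
have [eps eps0 surf] := C2_compact_measure_ge hC2 compG.
have C10 : 0 < 1 + `|Cnu| by rewrite ltr_pwDl.
have [C C0 H] := element_estimate n m C10 eps0.
exists eps, C; split=> // N K mK hnu hsize w i hK B wP.
have h0 : 0 < hK by apply: diameter_gt0 => //; exact: mesh_simplex mK i.
have [rho [c [hrho cK]]] := quasi_uniform_inscribed_ball h0 hnu.
apply: (H Gamma (K i) c rho w) => //.
by apply: le_lt_trans hsize; exact: diameter_le_mesh_size.
Qed.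

Theorem lemma1 (R : realType) (d : nat) (hd : d = 2%N \/ d = 3%N)
    (Omega Gamma : set 'rV[R]_d) (Omega_ : 'I_2 -> set 'rV[R]_d)
    (hOmega : polyhedral_domain Omega)
    (hGamma : interface Omega Gamma Omega_)
    (hC2 : C2_smooth Gamma)
    (m : nat) (hm : (1 <= m)%N) (Cnu : R) :
  exists h0 C : R, [/\ 0 < h0, 0 < C &
    forall (N : nat) (K : 'I_N -> 'M[R]_(d.+1, d)),
      mesh Omega K ->
      mesh_size K <= Cnu * mesh_inradius K ->
      admissible_cuts Omega Gamma Omega_ K ->
      mesh_size K < h0 ->
      forall (w : 'rV[R]_d -> R) (i : 'I_N), cuts Gamma (K i) ->
        let hK := diameter (K i) in
        let B := eball (barycenter (K i)) hK in
        poly_on m B w ->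
        (Lnorm_on (hausdorff d.-1) +oo (open_simplex (K i) `&` Gamma) w
         <= (C * hK `^ ((1 - d%:R) / 2))%:E *
            (Lnorm_on (hausdorff d.-1) 2 (Gamma `&` B) w
             + (hK `^ (2^-1))%:E *
               Lnorm_on lebesgue_rV 2 (open_simplex (K i))
                 (fun x => enorm (grad w x))))%E].
Proof.
case: d hd Omega Gamma Omega_ hOmega hGamma hC2 => [[]|n _]//.
move=> Omega Gamma Omega_ _ hGamma hC2.
have [h0 [C [h00 C0 H]]] := cut_element_estimate m Cnu hGamma hC2.
exists h0, C; split=> // N K mK hnu _ hsize w i _.
exact: H.
Qed.
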